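(* Let $S(x,q):=\sum_{n\ge 0} S_{n+1}^{(321)}(q)\, x^n$ and $\widetilde{S}(x,q):=\sum_{n\ge 1}\widetilde{S}_{n}^{(321)}(q)\, x^n$, where $S_n^{(321)}(q)=\sum_{\sigma\in S_n^{(321)}}q^{\ell(\sigma)}$ and $\widetilde{S}_n^{(321)}(q)=\sum_{\sigma\in \widetilde{S}_n^{(321)}}q^{\ell(\sigma)}$ are the length generating series of the $321$-avoiding permutations, respectively $321$-avoiding affine permutations, of size $n$. Let $$J(x):=\sum_{n\ge 0}\frac{(-x)^n q^{\binom n2}}{(q;q)_n(xq;q)_n}.$$ Then $$S(x,q)=\frac{1}{1-xq}\,\frac{J(xq)}{J(x)}\qquad\text{and}\qquad \widetilde{S}(x,q)=-x\frac{J'(x)}{J(x)}-\sum_{n\ge 1}\frac{x^nq^n}{1-q^n},$$ where the derivative is taken with respect to $x$.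
   Context: An affine permutation of size $n$ is a bijection $\sigma:\mathbb{Z}\to\mathbb{Z}$ such that $\sigma(i+n)=\sigma(i)+n$ for all $i\in\mathbb{Z}$ and $\sum_{i=1}^n\sigma(i)=\sum_{i=1}^n i$. These form a group $\widetilde{S}_n$ under composition. The symmetric group $S_n$ is regarded as a subgroup of $\widetilde{S}_n$ by extending $\sigma\in S_n$ to the unique affine permutation agreeing with $\sigma$ on $\{1,\dots,n\}$. An affine permutation is $321$-avoiding if there are no $i<j<k$ in $\mathbb{Z}$ with $\sigma(i)>\sigma(j)>\sigma(k)$. $\widetilde{S}_n^{(321)}$ is the set of $321$-avoiding elements of $\widetilde{S}_n$, and $S_n^{(321)}$ its subset of finite permutations (those in $S_n$). $\ell(\sigma)$ is the Coxeter length of $\sigma$ with respect to the generators $s_0=[0,2,\dots,n-1,n+1]$ and $s_i=[1,\dots,i-1,i+1,i,i+2,\dots,n]$ ($1\le i\le n-1$), where $[\sigma(1),\dots,\sigma(n)]$ is the window notation. It is a known fact that $\ell(\sigma)=\mathrm{inv}(\sigma):=|\{(i,j)\in\{1,\dots,n\}\times\mathbb{N}: i<j,\ \sigma(i)>\sigma(j)\}|$. For $n=1$ the group is trivial. $(x;q)_n:=(1-x)(1-xq)\cdots(1-xq^{n-1})$. All identities are between formal power series in $x$ and $q$. *)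

(* Defs.v *)
From HB Require Import structures.
From mathcomp Require Import all_boot all_order all_algebra.
From mathcomp Require Import perm finmap.
From mathcomp Require Import boolp classical_sets functions cardinality.

Set Implicit Arguments.
Unset Strict Implicit.
Unset Printing Implicit Defensive.

Import GRing.Theory.

Local Open Scope ring_scope.

(** * Formal power series in one variable

    The series in [x] and [q] are elements of Z[[q]][[x]], that is, of
    [fps (fps int)]. *)

Record fps (R : Type) := Fps { fps_coef : nat -> R }.

Notation "f `@ n" := (fps_coef f n)
  (at level 3, n at level 2, left associativity, format "f `@ n") : ring_scope.

Lemma fpsP (R : Type) (f g : fps R) : (forall n, f`@n = g`@n) -> f = g.
Proof. by case: f g => [f] [g] fg; congr Fps; apply: funext. Qed.

HB.instance Definition _ (R : Type) := gen_eqMixin (fps R).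
HB.instance Definition _ (R : Type) := gen_choiceMixin (fps R).

Section Zmodule.
Variable R : zmodType.
Implicit Types f g h : fps R.

Definition fps_zero : fps R := Fps (fun=> 0).
Definition fps_opp f : fps R := Fps (fun n => - f`@n).
Definition fps_add f g : fps R := Fps (fun n => f`@n + g`@n).

Lemma fps_addA : associative fps_add.
Proof. by move=> f g h; apply: fpsP => n /=; rewrite addrA. Qed.
Lemma fps_addC : commutative fps_add.
Proof. by move=> f g; apply: fpsP => n /=; rewrite addrC. Qed.
Lemma fps_add0 : left_id fps_zero fps_add.
Proof. by move=> f; apply: fpsP => n /=; rewrite add0r. Qed.
Lemma fps_addN : left_inverse fps_zero fps_opp fps_add.
Proof. by move=> f; apply: fpsP => n /=; rewrite addNr. Qed.

HB.instance Definition _ :=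
  GRing.isZmodule.Build (fps R) fps_addA fps_addC fps_add0 fps_addN.

End Zmodule.

Section Ring.
Variable R : comNzRingType.
Implicit Types f g h : fps R.

Definition fps_const (c : R) : fps R := Fps (fun n => if n is 0 then c else 0).

Definition fps_X : fps R := Fps (fun n => (n == 1%N)%:R).

Definition fps_mul f g : fps R :=
  Fps (fun n => \sum_(i < n.+1) f`@i * g`@(n - i)).

Let trunc n f : {poly R} := \poly_(i < n.+1) f`@i.

Let coef_trunc n f i : (i <= n)%N -> (trunc n f)`_i = f`@i.
Proof. by move=> le_in; rewrite coef_poly ltnS le_in. Qed.

Let coef_mul n f g i :
  (i <= n)%N -> (fps_mul f g)`@i = (trunc n f * trunc n g)`_i.
Proof.
move=> le_in; rewrite coefM; apply: eq_bigr => j _.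
have le_ji : (j <= i)%N by rewrite -ltnS.
by rewrite !coef_trunc ?(leq_trans _ le_in) ?leq_subr.
Qed.

Lemma fps_mulC : commutative fps_mul.
Proof. by move=> f g; apply: fpsP => n; rewrite !(@coef_mul n) // mulrC. Qed.

Lemma fps_mulA : associative fps_mul.
Proof.
move=> f g h; apply: fpsP => n.
transitivity ((trunc n f * trunc n g * trunc n h)`_n).
  rewrite -mulrA coefM; apply: eq_bigr => j _.
  by rewrite (@coef_mul n) ?leq_subr // coef_trunc // -ltnS.
rewrite coefM; apply: eq_bigr => j _.
have le_jn : (j <= n)%N by rewrite -ltnS.
by rewrite (@coef_mul n _ _ _ le_jn) coef_trunc ?leq_subr.
Qed.

Lemma fps_mul1 : left_id (fps_const 1) fps_mul.
Proof.
move=> f; apply: fpsP => n /=.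
by rewrite big_ord_recl subn0 mul1r big1 ?addr0 // => i _; rewrite mul0r.
Qed.

Lemma fps_mulDl : left_distributive fps_mul (@fps_add R).
Proof.
move=> f g h; apply: fpsP => n /=.
by rewrite -big_split; apply: eq_bigr => i _; rewrite mulrDl.
Qed.

Lemma fps_one_neq0 : fps_const 1 != 0 :> fps R.
Proof.
by apply/eqP => /(congr1 (@fps_coef R ^~ 0%N))/eqP; rewrite /= oner_eq0.
Qed.

HB.instance Definition _ := GRing.Zmodule_isComNzRing.Build (fps R)
  fps_mulA fps_mulC fps_mul1 fps_mulDl fps_one_neq0.

(** [f^-1] is the multiplicative inverse of [f] when it exists, and [f]
    otherwise; [fps_unitE] below says when it exists. *)

Definition fps_unit : pred (fps R) := fun f => `[< exists g, g * f = 1 >].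

Definition fps_inv f : fps R :=
  if pselect (exists g, g * f = 1) is left ex then projT1 (cid ex) else f.

Lemma fps_mulVr : {in fps_unit, left_inverse 1 fps_inv *%R}.
Proof.
move=> f /asboolP ex; rewrite /fps_inv.
by case: pselect => // ex'; case: cid.
Qed.

Lemma fps_unitP f g : g * f = 1 -> fps_unit f.
Proof. by move=> gf; apply/asboolP; exists g. Qed.

Lemma fps_inv_out : {in [predC fps_unit], fps_inv =1 id}.
Proof.
move=> f /negP nf; rewrite /fps_inv; case: pselect => // ex.
by case: nf; apply/asboolP.
Qed.

HB.instance Definition _ := GRing.ComNzRing_hasMulInverse.Build (fps R)
  fps_mulVr fps_unitP fps_inv_out.

(** The formal derivative [f']. *)
Definition fps_deriv f : fps R := Fps (fun n => f`@n.+1 *+ n.+1).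

(** The substitution [f(c x)]. *)
Definition fps_scale (c : R) f : fps R := Fps (fun n => c ^+ n * f`@n).

(** The infinite sum of the [F n], for families in which [F n] is divisible by
    [x ^ n], so that only [F 0], ..., [F m] contribute to the coefficient of
    [x ^ m]; see [fps_sum_stable]. *)
Definition fps_sum (F : nat -> fps R) : fps R :=
  Fps (fun m => \sum_(n < m.+1) (F n)`@m).

End Ring.

Arguments fps_X {R}.

Section RingTheory.
Variable R : comNzRingType.
Implicit Types f g : fps R.

Lemma fps_coef_sum I (r : seq I) (P : pred I) (F : I -> fps R) m :
  (\sum_(i <- r | P i) F i)`@m = \sum_(i <- r | P i) (F i)`@m.
Proof. by apply: (big_morph (fun f : fps R => f`@m)). Qed.

Lemma fps_coefM f g n : (f * g)`@n = \sum_(i < n.+1) f`@i * g`@(n - i).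
Proof. by []. Qed.

Lemma fps_coef0M f g : (f * g)`@0 = f`@0 * g`@0.
Proof. by rewrite fps_coefM big_ord_recl big_ord0 addr0. Qed.

Lemma fps_coef0_1BM f g : (1 - f * g)`@0 = 1 - f`@0 * g`@0.
Proof. by rewrite -fps_coef0M. Qed.

Lemma fps_coefMX f n : (fps_X * f)`@n = if n is m.+1 then f`@m else 0.
Proof.
rewrite fps_coefM; case: n => [|n].
  by rewrite big_ord_recl big_ord0 /= mul0r addr0.
rewrite big_ord_recl /= mul0r add0r big_ord_recl /= mul1r subSS subn0.
by rewrite big1 ?addr0 // => i _; rewrite mul0r.
Qed.

Lemma fps_coefMXn f n m :
  (fps_X ^+ n * f)`@m = if (m < n)%N then 0 else f`@(m - n).
Proof.
elim: n m => [|n IHn] m; first by rewrite mul1r subn0.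
by rewrite exprS -mulrA fps_coefMX; case: m => // m; rewrite IHn subSS.
Qed.

Lemma fps_sum_stable (F : nat -> fps R) m N :
    (forall n k, (k < n)%N -> (F n)`@k = 0) -> (m < N)%N ->
  (\sum_(n < N) F n)`@m = (fps_sum F)`@m.
Proof.
move=> F0 ltmN; rewrite fps_coef_sum -(subnKC ltmN) big_split_ord /=.
by rewrite [X in _ + X]big1 ?addr0 // => i _; rewrite F0 // leq_addr.
Qed.

End RingTheory.

Section UnitRing.
Variable R : comUnitRingType.
Implicit Types f : fps R.

Let inv_coefs f := fix F n : seq R := if n is m.+1 then
  let s := F m in
  rcons s ((f`@0)^-1 * ((m == 0%N)%:R - \sum_(i < m) s`_i * f`@(m - i)))
  else [::].

Let size_inv_coefs f n : size (inv_coefs f n) = n.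
Proof. by elim: n => //= n IHn; rewrite size_rcons IHn. Qed.

Let nth_inv_coefs f n i : (i < n)%N ->
  (inv_coefs f n)`_i = (inv_coefs f i.+1)`_i.
Proof.
elim: n => // n IHn; rewrite ltnS leq_eqVlt => /predU1P[->//|lt_in].
by rewrite [LHS]/= nth_rcons size_inv_coefs lt_in IHn.
Qed.

Lemma fps_unitE f : (f \is a GRing.unit) = (f`@0 \is a GRing.unit).
Proof.
apply/idP/idP => [/mulVr/(congr1 (@fps_coef R ^~ 0%N))|f0].
  rewrite fps_coefM big_ord_recl big_ord0 addr0 subn0 => fV.
  by apply/unitrPr; exists (f^-1)`@0; rewrite mulrC.
pose g := Fps (fun n => (inv_coefs f n.+1)`_n).
apply/unitrPr; exists g; rewrite mulrC; apply: fpsP => n.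
rewrite fps_coefM big_ord_recr /= subnn nth_rcons size_inv_coefs ltnn eqxx.
rewrite mulrAC mulVr // mul1r addrC.
under [X in _ - X]eq_bigr => i _ do rewrite nth_inv_coefs //.
by rewrite subrK; case: n.
Qed.

End UnitRing.

(** * Affine permutations *)

Section Affine.
Local Open Scope classical_set_scope.

Definition affine_perm (n : nat) (s : int -> int) : Prop :=
  [/\ bijective s,
      forall i : int, s (i + n%:Z) = s i + n%:Z
    & \sum_(1 <= i < n.+1) s i%:Z = \sum_(1 <= i < n.+1) i%:Z].

(** The elements of [S_n] inside the affine group: ['I_n] is {0, ..., n-1},
    whence the shift to {1, ..., n}. *)
Definition finite_perm (n : nat) (s : int -> int) : Prop :=
  affine_perm n s /\
  exists p : 'S_n, forall i : 'I_n, s i.+1%:Z = (p i).+1%:Z.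

Definition avoids321 (s : int -> int) : Prop :=
  ~ exists i j k : int, [/\ i < j, j < k, s j < s i & s k < s j].

(** The generator [s_i] exchanges [i + a n] and [i + 1 + a n] for all [a]; in
    particular [s_0] has window [0, 2, ..., n-1, n+1]. *)
Definition simple_refl (n i : nat) (j : int) : int :=
  if (j == i%:Z %[mod n%:Z])%Z then j + 1
  else if (j == i.+1%:Z %[mod n%:Z])%Z then j - 1
  else j.

(** Words in the generators [s_0, ..., s_(n-1)], encoded by their indices;
    there are no generators when [n = 1]. *)
Definition is_word (n : nat) (w : seq nat) : bool :=
  all (fun i => (1 < n)%N && (i < n)%N) w.

Definition word_prod (n : nat) (w : seq nat) : int -> int :=
  foldr (fun i f => simple_refl n i \o f) idfun w.

(** [coxeter_length n s k] means that the length of [s] is [k]. *)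
Definition coxeter_length (n : nat) (s : int -> int) (k : nat) : Prop :=
  (exists w, [/\ is_word n w, word_prod n w = s & size w = k]) /\
  (forall w, is_word n w -> word_prod n w = s -> (k <= size w)%N).

Definition affine321_of_length (n k : nat) : set (int -> int) :=
  [set s | [/\ affine_perm n s, avoids321 s & coxeter_length n s k]].

Definition finite321_of_length (n k : nat) : set (int -> int) :=
  [set s | [/\ finite_perm n s, avoids321 s & coxeter_length n s k]].

(** [fset_set] is the empty set on infinite sets; this does not occur below. *)
Lemma finite_affine321 n k : finite_set (affine321_of_length n k).
Proof.
pose f (t : k.-tuple 'I_n) := word_prod n (map val t).
apply: (@sub_finite_set _ _ (f @` setT)); last exact/finite_image/finite_finset.
move=> s [_ _ [[w [wn <- szw]] _]].
have sz : size (pmap (insub : nat -> option 'I_n) w) == k.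
  rewrite size_pmap_sub -szw -all_count.
  by apply: sub_all wn => i /andP[].
exists (Tuple sz) => //; rewrite /f /= (pmap_filter (insubK _)).
congr word_prod; apply/all_filterP; apply: sub_all wn => i /andP[_ ltin].
by rewrite /= insubT.
Qed.

Lemma finite_finite321 n k : finite_set (finite321_of_length n k).
Proof.
apply: sub_finite_set (finite_affine321 n k) => s [[sn _] s321 sk].
by split.
Qed.

Local Open Scope fset_scope.

Definition S321_poly (n : nat) : fps int :=
  Fps (fun k => #|` fset_set (finite321_of_length n k)|%:Z).

Definition aff_S321_series (n : nat) : fps int :=
  Fps (fun k => #|` fset_set (affine321_of_length n k)|%:Z).

End Affine.

(** * The series in [x] and [q] *)

Definition qpoch (R : pzRingType) (a q : R) (n : nat) : R :=
  \prod_(i < n) (1 - a * q ^+ i).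

Definition base_q : fps int := fps_X.

Definition var_x : fps (fps int) := fps_X.
Definition var_q : fps (fps int) := fps_const base_q.

(** The sum over [n >= 0] of [S_(n+1)(q) x^n]. *)
Definition S_xq : fps (fps int) := Fps (fun n => S321_poly n.+1).

Definition aff_S_xq : fps (fps int) :=
  Fps (fun n => if n is 0 then 0 else aff_S321_series n).

Definition J_term (n : nat) : fps (fps int) :=
  (- var_x) ^+ n * var_q ^+ 'C(n, 2) /
  (qpoch var_q var_q n * qpoch (var_x * var_q) var_q n).

Definition J : fps (fps int) := fps_sum J_term.

Lemma J_term_ord n k : (k < n)%N -> (J_term n)`@k = 0.
Proof.
move=> ltkn; rewrite /J_term exprNn mulrAC -!mulrA mulrC -!mulrA.
by rewrite fps_coefMXn ltkn.
Qed.

(** The sum over [n >= 1] of [x^n q^n / (1 - q^n)]. *)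
Definition lambert_xq : fps (fps int) :=
  Fps (fun n => if n is 0 then 0 else base_q ^+ n / (1 - base_q ^+ n)).

(** All the inverses taken here and in the theorem are genuine. *)

Lemma qpoch_unit (a : fps (fps int)) n :
  (a`@0)`@0 = 0 -> qpoch a var_q n \is a GRing.unit.
Proof.
move=> a0; rewrite unitr_prod_in // => i _.
by rewrite 2!fps_unitE 2!fps_coef0_1BM a0 mul0r subr0 unitr1.
Qed.

Lemma J_term_unit n :
  qpoch var_q var_q n * qpoch (var_x * var_q) var_q n \is a GRing.unit.
Proof.
rewrite unitrM; apply/andP; split; apply: qpoch_unit => //.
by rewrite 2!fps_coef0M mul0r.
Qed.

Lemma prefactor_unit : 1 - var_x * var_q \is a GRing.unit.
Proof. by rewrite 2!fps_unitE 2!fps_coef0_1BM mul0r subr0 unitr1. Qed.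

Lemma J_unit : J \is a GRing.unit.
Proof.
have J0 : J`@0 = (J_term 0)`@0 by exact: big_ord1.
rewrite fps_unitE J0 /J_term /qpoch !big_ord0 bin0n !expr0 !mulr1 divr1.
exact: unitr1.
Qed.

Lemma lambert_unit n : (0 < n)%N -> 1 - base_q ^+ n \is a GRing.unit.
Proof.
by case: n => // n _; rewrite fps_unitE exprS fps_coef0_1BM mul0r subr0 unitr1.
Qed.

(* Main.v *)
(* Idea.  Read a 321-avoiding affine permutation [s] of size [n] position by
   position, recording at [z] whether [z <= s z] and whether the position sent
   to [z] is at most [z].  The number of [y < z] with [z <= s y] then performs a
   closed Motzkin walk of length [n], with two kinds of level steps at positive
   heights and one kind at height 0, and the length of [s] is the sum of the
   heights.  All closed walks occur, except those of constant positive height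
   using only one kind of step; the finite permutations are the walks that start
   at height 0.

   With heights at most [K], walks are counted by the powers of a tridiagonal
   transfer matrix [A].  Modulo [q ^ K], the matrix [1 - x A] is a product of two
   bidiagonal matrices whose pivots are ratios of shifts of [J] and of an
   auxiliary series [H], because [J] and [H] satisfy contiguous q-difference
   equations.  The upper left entry of the inverse is then [H / J], and Jacobi's
   formula for the derivative of a determinant yields the trace generating
   function [- x J' / J + sum_(n >= 1) x^n q^n / (1 - q^n)]. *)

From HB Require Import structures.
Require Import Defs.
From mathcomp Require Import all_boot all_order all_algebra.
From mathcomp Require Import perm finmap.
From mathcomp Require Import boolp classical_sets functions cardinality.
From mathcomp Require Import zify ring lra.

Set Implicit Arguments.
Unset Strict Implicit.
Unset Printing Implicit Defensive.

Import Order.TTheory GRing.Theory Num.Theory.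

Local Open Scope ring_scope.

(** * Affine permutations *)

(** On 321-avoiding permutations the length is half of the total displacement, and the displacement
    is twice the area under the walk. Both facts come from undoing a descent, which cuts one unit of
    area at a peak of the walk.

    Heights are unbounded, so the natural matrix is infinite. A walk of area [k] has heights at most
    [k], hence a given coefficient in [q] needs only a finite truncation; but the exact pivots of a
    truncated matrix depend on [K]. The factorization is upper times lower, so that elimination runs
    from large heights down: in the infinite matrix the pivots are tails of a continued fraction,
    and these are the ratios of shifts of [H]. Using them in the truncated matrix spoils a single
    corner entry, by a multiple of [q ^ K].

    The last sign comes from the flat walks. One of length [n] and height [h] has area [n h] and two
    possible labels, so together they contribute 2 L, where L is the sum of x^n q^n / (1 - q^n); the
    trace is - x J' / J + L, which leaves - L. At height 0 the closed walks give H / J = 1 + x S(x,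
    q), and H = J + x J(xq) / (1 - xq). *)

Section Periodic.
Variable n' : nat.
Local Notation n := n'.+1.
Implicit Types (x y z : int).

Definition periodic (T : Type) (F : int -> T) := forall x, F (x + n%:Z) = F x.

Lemma periodicZ (T : Type) (F : int -> T) : periodic F ->
  forall x k, F (x + k * n%:Z) = F x.
Proof.
move=> perF x k; have perN m y : F (y + m%:Z * n%:Z) = F y.
  elim: m y => [|m IHm] y; first by rewrite mul0r addr0.
  by rewrite intS mulrDl mul1r addrA IHm perF.
case: (intP k) => [|m|m]; first by rewrite mul0r addr0.
  exact: perN.
by rewrite -(perN m.+1) mulNr subrK.
Qed.

Lemma eqmodP x y :
  reflect (exists k, x = y + k * n%:Z) (x == y %[mod n%:Z])%Z.
Proof.
rewrite eqz_mod_dvd; apply: (iffP dvdzP) => -[k xy]; exists k.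
  by rewrite -xy addrC subrK.
by rewrite xy addrC addKr.
Qed.

(* The index of [x] modulo [n] in the window 1, ..., n. *)
Definition res x : 'I_n := inord `|((x - 1) %% n%:Z)%Z|.

Lemma resP x : exists k, x = (res x).+1%:Z + k * n%:Z.
Proof.
exists ((x - 1) %/ n%:Z)%Z; rewrite /res inordK; last first.
  have := @ltz_pmod (x - 1) n%:Z isT.
  by have := @modz_ge0 (x - 1) n%:Z isT; lia.
have := divz_eq (x - 1) n%:Z; have := @modz_ge0 (x - 1) n%:Z isT.
set u := (_ %% _)%Z; set v := (_ %/ _)%Z; lia.
Qed.

Lemma res_unique x (j : 'I_n) k : x = j.+1%:Z + k * n%:Z -> res x = j.
Proof.
move=> xj; have [k' xr] := resP x; apply: val_inj => /=.
have ltj := ltn_ord j; have ltr := ltn_ord (res x).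
have {xj xr} jr : j.+1%:Z + k * n%:Z = (res x).+1%:Z + k' * n%:Z by rewrite -xj.
move: (j : nat) (res x : nat) ltj ltr jr => {}j r ltj ltr jr.
by have [||] := ltgtP k k'; nia.
Qed.

Lemma resE (j : 'I_n) : res j.+1%:Z = j.
Proof. by apply: (@res_unique _ _ 0); rewrite mul0r addr0. Qed.

Lemma periodic_res (T : Type) (F : int -> T) : periodic F ->
  forall x, F x = F (res x).+1%:Z.
Proof. by move=> perF x; have [k {1}->] := resP x; exact: periodicZ. Qed.

Lemma eqmod_res x y : (x == y %[mod n%:Z])%Z = (res x == res y).
Proof.
apply/eqmodP/eqP => [[k ->]|xy].
  have [k' {1}->] := resP y; apply: (@res_unique _ _ (k' + k)).
  by rewrite mulrDl addrA.
have [k1 e1] := resP x; have [k2 e2] := resP y; exists (k1 - k2).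
by rewrite e1 {1}e2 xy; ring.
Qed.

(** Upward steps suffice, since adding enough periods to [y] brings it above [x]. *)
Lemma periodic_ind (P : int -> bool) : periodic P ->
  (forall x, P x -> P (x + 1)) -> forall x y, P x -> P y.
Proof.
move=> perP step x y Px.
have up m z : P z -> P (z + m%:Z).
  elim: m z => [|m IHm] z Pz; first by rewrite addr0.
  by rewrite intS addrA IHm // step.
pose k := absz (y - x)%R.
rewrite -(periodicZ perP y k%:Z).
have -> : y + k%:Z * n%:Z = x + (absz (y + k%:Z * n%:Z - x)%R)%:Z by nia.
exact: up.
Qed.

Section Wsum.
Variable V : zmodType.

Definition wsum (F : int -> V) : V := \sum_(j < n) F j.+1%:Z.

(** As many points as there are classes, pairwise distinct modulo [n], meet every class exactly
    once. *)
Lemma wsum_reindex (F : int -> V) (phi : 'I_n -> int) : periodic F ->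
  (forall i j, (phi i == phi j %[mod n%:Z])%Z -> i = j) ->
  \sum_(j < n) F (phi j) = wsum F.
Proof.
move=> perF inj; have inj' : injective (fun j => res (phi j)).
  by move=> i j /eqP; rewrite -eqmod_res; exact: inj.
rewrite /wsum [RHS](reindex_inj inj') /=.
by apply: eq_bigr => j _; rewrite -periodic_res.
Qed.

Lemma eq_wsum (F G : int -> V) : F =1 G -> wsum F = wsum G.
Proof. by move=> FG; apply: eq_bigr. Qed.

Lemma wsumD (F G : int -> V) : wsum (fun x => F x + G x) = wsum F + wsum G.
Proof. exact: big_split. Qed.

Lemma wsumN (F : int -> V) : wsum (fun x => - F x) = - wsum F.
Proof. exact: sumrN. Qed.

End Wsum.

Lemma wsum_class y : wsum (fun x => ((x == y %[mod n%:Z])%Z : nat)%:Z) = 1.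
Proof.
rewrite /wsum (bigD1 (res y)) //= eqmod_res resE eqxx big1 // => j.
by rewrite eqmod_res resE => /negPf ->.
Qed.

Definition shifting (s : int -> int) := forall x, s (x + n%:Z) = s x + n%:Z.

Lemma shiftingZ s : shifting s -> forall x k, s (x + k * n%:Z) = s x + k * n%:Z.
Proof.
move=> ss x k.
have perd : periodic (fun x => s x - x) by move=> z; rewrite ss; ring.
by have := periodicZ perd x k; lia.
Qed.

Lemma shifting_mod_inj s : shifting s -> injective s ->
  forall x y, (s x == s y %[mod n%:Z])%Z -> (x == y %[mod n%:Z])%Z.
Proof.
move=> ss inj x y /eqmodP[k sxy]; apply/eqmodP; exists k; apply: inj.
by rewrite shiftingZ.
Qed.

Lemma wsum_comp (V : zmodType) (F : int -> V) s : periodic F -> shifting s ->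
  injective s -> wsum (F \o s) = wsum F.
Proof.
move=> perF ss inj.
apply: (wsum_reindex (phi := fun j => s j.+1%:Z)) => // i j ij.
apply/eqP; rewrite -(resE i) -(resE j) -eqmod_res.
exact: shifting_mod_inj ij.
Qed.

Lemma wsum_opp (V : zmodType) (F : int -> V) m : periodic F ->
  \sum_(j < n) F (m - j%:Z) = wsum F.
Proof.
move=> perF; apply: (wsum_reindex (phi := fun j => m - j%:Z)) => // i j.
move=> /eqmodP[k ij]; apply: val_inj => /=.
move: (ltn_ord i) (ltn_ord j) ij; move: (i : nat) (j : nat) => {}i {}j.
by have [||] := ltgtP k 0; nia.
Qed.

End Periodic.

Section AffinePermutations.
Variable n' : nat.
Local Notation n := n'.+1.
Implicit Types (x y z m : int) (s : int -> int).
Local Notation wsum := (@wsum n' _).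
Local Notation "x =%n y" := (x == y %[mod n%:Z])%Z (at level 70).

(** Since [s x - x] is periodic, this form of the normalization can be evaluated on any complete set
    of residues. *)
Lemma affine_permP s : affine_perm n s <->
  [/\ bijective s, shifting n' s & wsum (fun x => s x - x) = 0].
Proof.
have sumE : wsum (fun x => s x - x) =
    \sum_(1 <= i < n.+1) s i%:Z - \sum_(1 <= i < n.+1) i%:Z.
  by rewrite wsumD wsumN !big_add1 !big_mkord.
split=> -[bij sh sum]; split=> //; first by rewrite sumE sum subrr.
by apply/eqP; rewrite -subr_eq0 -sumE sum.
Qed.

Lemma affine_perm_id : affine_perm n idfun.
Proof.
apply/affine_permP; split=> //.
by apply: big1 => j _; rewrite subrr.
Qed.

Lemma affine_perm_sum_opp s m : affine_perm n s ->
  \sum_(j < n) s (m - j%:Z) = \sum_(j < n) (m - j%:Z).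
Proof.
move=> /affine_permP[bij ss sum]; apply/eqP; rewrite -subr_eq0 -sumrB.
rewrite (wsum_opp (F := fun x => s x - x)) ?sum // => x.
by rewrite ss; ring.
Qed.

(* Reduce the values of [s] at [m - j] modulo [n] into the window ending at
   [m']: this cannot decrease them, and permutes the window. *)
Lemma affine_perm_le s m (m' : int) : affine_perm n s ->
  (forall x, x <= m -> s x <= m') -> m <= m'.
Proof.
move=> sa le_s; have /affine_permP[/bij_inj inj ss _] := sa.
pose F y := ((m' - y) %% n%:Z)%Z.
have perF : periodic n' F.
  by move=> y; rewrite /F opprD addrA addrC -mulN1r modzMDl.
have leF y : y <= m' -> F y <= m' - y.
  move=> le_y; have y0 : 0 <= m' - y by rewrite subr_ge0.
  by rewrite /F {2}(divz_eq (m' - y) n%:Z) lerDr mulr_ge0 ?divz_ge0.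
have perFs : periodic n' (F \o s) by move=> y; rewrite /= ss perF.
have : \sum_(j < n) F (s (m - j%:Z)) <= \sum_(j < n) (m' - s (m - j%:Z)).
  by apply: ler_sum => j _; apply: leF; apply: le_s; rewrite gerBl.
rewrite (wsum_opp _ perFs) (wsum_comp perF) // -(wsum_opp m' perF).
under eq_bigr => j _ do
  rewrite /F opprB addrC subrK modz_small ?ltz_nat ?ltn_ord //.
rewrite !sumrB (affine_perm_sum_opp _ sa) sumrB !sumr_const !card_ord.
by rewrite opprB addrCA lerDl subr_ge0 lerMn2r.
Qed.

(** Conjugation by negation preserves affine permutations and turns this into [affine_perm_le]. *)
Lemma affine_perm_ge s m (m' : int) : affine_perm n s ->
  (forall x, m <= x -> m' <= s x) -> m' <= m.
Proof.
move=> sa le_s; pose t x := - s (- x).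
suff ta : affine_perm n t.
  by rewrite -lerN2; apply: (affine_perm_le ta) => x mx; rewrite lerN2 le_s; lia.
have /affine_permP[[g gK Kg] ss sum] := sa; apply/affine_permP; split.
- by exists (fun x => - g (- x)) => x; rewrite /t ?opprK ?gK ?Kg opprK.
- move=> x; have nx : - x = - (x + n%:Z) + n%:Z by ring.
  by rewrite /t nx ss; ring.
have per : periodic n' (fun x => s x - x) by move=> x; rewrite ss; ring.
rewrite -oppr0 -sum -(wsum_opp (-1) per) -sumrN; apply: eq_bigr => j _.
have -> : -1 - j%:Z = - j.+1%:Z by lia.
by rewrite opprB addrC.
Qed.

(** * Simple reflections and total displacement *)

Section Reflection.
Variable i : nat.
Hypothesis n_gt1 : (1 < n)%N.
Local Notation si := (simple_refl n i).

Lemma class_succ x : (x + 1 =%n i.+1%:Z) = (x =%n i%:Z).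
Proof.
apply/eqmodP/eqmodP => -[k e]; exists k; move: e; rewrite intS; first by lia.
by move=> ->; ring.
Qed.

Lemma class_excl x : x =%n i%:Z -> (x =%n i.+1%:Z) = false.
Proof.
move=> /eqmodP[k ->]; apply/eqmodP => -[k' e].
by have [||] := ltgtP k k'; nia.
Qed.

Lemma class_excl' x : x =%n i.+1%:Z -> (x =%n i%:Z) = false.
Proof. by move=> xi; apply/negP => /class_excl; rewrite xi. Qed.

Variant refl_spec x : int -> bool -> bool -> Type :=
| ReflUp of x =%n i%:Z & (x + 1 =%n i.+1%:Z) : refl_spec x (x + 1) true false
| ReflDown of x =%n i.+1%:Z & (x - 1 =%n i%:Z) : refl_spec x (x - 1) false true
| ReflFix of ~~ (x =%n i%:Z) & ~~ (x =%n i.+1%:Z) :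
    refl_spec x x false false.

Lemma reflP x : refl_spec x (si x) (x =%n i%:Z) (x =%n i.+1%:Z).
Proof.
rewrite /simple_refl; case: ifP => xi.
  by rewrite class_excl //; constructor; rewrite // class_succ.
case: ifP => xi'; last by constructor; rewrite ?xi ?xi'.
by constructor; rewrite // -class_succ subrK.
Qed.

Lemma reflK : involutive si.
Proof.
move=> x; case: (reflP x) => [xi xi'|xi xi'|/negPf xi /negPf xi'].
- by case: (reflP (x + 1)) xi' => // *; lia.
- by case: (reflP (x - 1)) xi' => // *; lia.
- by rewrite /simple_refl xi xi'.
Qed.

Lemma refl_shifting : shifting n' si.
Proof.
move=> x; have cls y : (x + n%:Z =%n y) = (x =%n y).
  by rewrite modzDr.
rewrite /simple_refl !cls; case: ifP => _; first by rewrite addrAC.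
by case: ifP => _ //; rewrite addrAC.
Qed.

Lemma refl_bij : bijective si. Proof. exact: inv_bij reflK. Qed.

Lemma refl_affine s : affine_perm n s -> affine_perm n (s \o si).
Proof.
move=> /affine_permP[bij ss sum]; apply/affine_permP; split.
- exact: bij_comp bij refl_bij.
- by move=> x; rewrite /= refl_shifting ss.
have per : periodic n' (fun x => s x - x) by move=> x; rewrite ss; ring.
have siE x : si x - x = (x =%n i%:Z : nat)%:Z - (x =%n i.+1%:Z : nat)%:Z.
  by case: reflP => * /=; lia.
have -> : wsum (fun x => (s \o si) x - x) =
    wsum (fun x => (s (si x) - si x) + (si x - x)).
  by apply: eq_wsum => x /=; ring.
rewrite wsumD (wsum_comp per refl_shifting (bij_inj refl_bij)) sum add0r.
by rewrite (eq_wsum _ siE) wsumD wsumN !wsum_class subrr.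
Qed.

(** The reflection is injective and moves points by at most 1, so only adjacent points can be
    reversed. *)
Lemma refl_lt x y : x < y -> si x < si y \/ (y = x + 1 /\ x =%n i%:Z).
Proof.
move=> lt_xy; have : si x != si y.
  by rewrite (inj_eq (bij_inj refl_bij)); apply: contraTneq lt_xy => ->; lia.
have [e|ne] := eqVneq y (x + 1).
  rewrite e; case: (reflP x) => xi *; first by right.
    by left; case: (reflP (x + 1)) => *; lia.
  by left; move: (class_succ x) xi; case: (reflP (x + 1)) => [_ _ _|//|]; lia.
by case: (reflP x); case: (reflP y) => *; left; lia.
Qed.

(** [si] carries a 321 pattern of [s \o si] to one of [s]: the pairs whose order it reverses are
    descents of [s], so they are ascents of [s \o si] and lie in no pattern. *)
Lemma refl_avoids321 s : avoids321 s ->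
  (forall x, x =%n i%:Z -> s (x + 1) < s x) -> avoids321 (s \o si).
Proof.
move=> s321 desc [x [y [z [xy yz sxy syz]]]]; apply: s321.
have lt u v : u < v -> s (si v) < s (si u) -> si u < si v.
  move=> /refl_lt[//|[-> ui]].
  rewrite -class_succ in ui; move: ui (desc (si (u + 1))).
  case: (reflP (u + 1)) => // _; rewrite addrK => ui _ /(_ ui).
  have -> : si u = u + 1 by rewrite /simple_refl ui.
  by lia.
by exists (si x), (si y), (si z); split=> //; exact: lt.
Qed.

(* On 321-avoiding permutations this is twice the length; each simple
   reflection changes it by at most 2. *)
Definition disp s := wsum (fun x => `|s x - x|).

(** Each of the two exchanged values ends one place farther from its position, once per window. *)
Lemma disp_refl s : shifting n' s ->
    (forall x, x =%n i%:Z -> s x <= x /\ x + 1 <= s (x + 1)) ->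
  disp (s \o si) = disp s + 2.
Proof.
move=> ss asc; have per : periodic n' (fun x => `|s x - x|).
  by move=> x; rewrite ss; congr `| _ |; ring.
have -> : disp (s \o si) = wsum (fun x => `|s (si x) - si x| +
    ((x =%n i%:Z : nat)%:Z + (x =%n i.+1%:Z : nat)%:Z)).
  apply: eq_wsum => x /=; case: (reflP x) => [xi _|_ xi|_ _].
  - by have [] := asc _ xi; lia.
  - by have [] := asc _ xi; rewrite subrK; lia.
  - by rewrite !addr0.
rewrite wsumD (wsum_comp per refl_shifting (bij_inj refl_bij)).
by rewrite wsumD !wsum_class.
Qed.

(** Only the values in the classes of [i] and [i + 1] move, each by 1, and [s] reaches each class
    once per window. *)
Lemma refl_disp s : shifting n' s -> injective s ->
  disp (si \o s) <= disp s + 2.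
Proof.
move=> ss inj.
pose c y x := (x =%n y : nat)%:Z.
have -> : disp s + 2 = wsum (fun x => `|s x - x| +
    (c i%:Z (s x) + c i.+1%:Z (s x))).
  rewrite wsumD wsumD.
  have perc y : periodic n' (c y) by move=> x; rewrite /c modzDr.
  by rewrite !(wsum_comp (perc _) ss inj) !wsum_class.
by apply: ler_sum => j _ /=; rewrite /c; case: reflP => *; lia.
Qed.

End Reflection.
End AffinePermutations.

(** * Coxeter length of 321-avoiding permutations *)

Section Length.
Variable n' : nat.
Local Notation n := n'.+1.
Implicit Types (x y z : int) (s : int -> int).
Local Notation wsum := (@wsum n' _).
Local Notation disp := (disp n').
Local Notation "x =%n y" := (x == y %[mod n%:Z])%Z (at level 70).

(** [s x - x] is weakly increasing and periodic, hence constant, and its sum over the window is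
    zero. *)
Lemma affine_perm_increasing s : affine_perm n s ->
  (forall x, s x < s (x + 1)) -> s = idfun.
Proof.
move=> /affine_permP[bij ss sum] incr.
have dE x y : s x - x <= s y - y.
  apply: (@periodic_ind n' (fun y => s x - x <= s y - y) _ _ x) => // [z|z].
    by rewrite ss; congr (_ <= _); ring.
  by have := incr z; lia.
apply: funext => x /=; have : wsum (fun=> s x - x) = 0.
  by rewrite -sum; apply: eq_wsum => y; apply/eqP; rewrite eq_le !dE.
rewrite /wsum sumr_const card_ord => /eqP; rewrite mulrn_eq0 /=; lia.
Qed.

(** At a descent, a larger value to the left of [x] would complete a 321 pattern. So [s x] is the
    maximum of [s] up to [x + 1], and [affine_perm_le] gives [x + 1 <= s x]; the other bound is
    dual. *)
Lemma avoids321_descent s : affine_perm n s -> avoids321 s -> s <> idfun ->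
  exists i, [/\ (1 < n)%N, (i < n)%N &
    forall x, x =%n i%:Z -> x + 1 <= s x /\ s (x + 1) <= x].
Proof.
move=> sa s321 s_id; have /affine_permP[bij ss _] := sa.
have [x desc] : exists x, s (x + 1) < s x.
  apply: contrapT => /forallNP noex; apply: s_id.
  apply: affine_perm_increasing sa _ => x; rewrite lt_neqAle.
  rewrite (inj_eq (bij_inj bij)) leNgt; have /negP -> := noex x.
  by rewrite andbT; lia.
exists (absz (x %% n%:Z)%Z); split.
- rewrite ltnNge; apply/negP => n1; have n0 : n' = 0%N by lia.
  by have := ss x; rewrite n0 => sx1; move: desc; rewrite sx1; lia.
- by have := @ltz_pmod x n%:Z isT; have := @modz_ge0 x n%:Z isT; lia.
have s_lo : x + 1 <= s x.
  apply: affine_perm_le sa _ => z zx; rewrite leNgt; apply/negP => sz.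
  have [zx1|zx1] := eqVneq z (x + 1); first by move: sz; rewrite zx1; lia.
  have [zx0|zx0] := eqVneq z x; first by move: sz; rewrite zx0; lia.
  by apply: s321; exists z, x, (x + 1); split=> //; lia.
have s_hi : s (x + 1) <= x.
  apply: affine_perm_ge sa _ => z zx; rewrite leNgt; apply/negP => sz.
  have [zx1|zx1] := eqVneq z (x + 1); first by move: sz; rewrite zx1; lia.
  have [zx0|zx0] := eqVneq z x; first by move: sz; rewrite zx0; lia.
  by apply: s321; exists x, (x + 1), z; split=> //; lia.
move=> y; rewrite gez0_abs ?modz_ge0 // modz_mod => /eqmodP[k ->].
by rewrite addrAC !shiftingZ // !lerD2r.
Qed.

Lemma disp_ge0 s : 0 <= disp s. Proof. exact: sumr_ge0. Qed.

Lemma disp_id : disp idfun = 0.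
Proof. by apply: big1 => j _ /=; rewrite subrr. Qed.

(** Undoing a descent lowers [disp] by 2, so the identity is reached. The condition on [s x] and
    [s (x + 1)] says more than that there is an ascent: it makes [disp] grow by exactly 2. *)
Lemma avoids321_ind (P : (int -> int) -> Prop) : P idfun ->
  (forall i s, (1 < n)%N -> (i < n)%N -> affine_perm n s -> avoids321 s ->
    (forall x, x =%n i%:Z -> s x <= x /\ x + 1 <= s (x + 1)) ->
    P s -> P (s \o simple_refl n i)) ->
  forall s, affine_perm n s -> avoids321 s -> P s.
Proof.
move=> P1 PS s; have [k] := ubnP (absz (disp s)).
elim: k s => // k IHk s lt_k sa s321.
have [-> //|s_id] := pselect (s = idfun).
have [i [n_gt1 ltin desc]] := avoids321_descent sa s321 s_id.
pose t := s \o simple_refl n i.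
have ta : affine_perm n t by exact: refl_affine.
have t321 : avoids321 t.
  by apply: refl_avoids321 => // x /desc; lia.
have asc x : x =%n i%:Z -> t x <= x /\ x + 1 <= t (x + 1).
  move=> xi; have := desc x xi; rewrite /t /=.
  case: (reflP i n_gt1 x) xi => // _ xi _.
  by case: (reflP i n_gt1 (x + 1)) xi => // *; rewrite addrK; lia.
have sE : s = t \o simple_refl n i.
  by apply: funext => x; rewrite /t /= reflK.
rewrite sE; apply: PS => //; apply: IHk => //.
have /affine_permP[_ st _] := ta.
have := disp_refl n_gt1 st asc; rewrite -sE.
by have := disp_ge0 t; lia.
Qed.

Lemma word_prod_rcons w i :
  word_prod n (rcons w i) = word_prod n w \o simple_refl n i.
Proof. by elim: w => //= j w ->. Qed.

Lemma word_prodP w : is_word n w ->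
  [/\ bijective (word_prod n w), shifting n' (word_prod n w)
    & disp (word_prod n w) <= (size w).*2%:Z].
Proof.
elim: w => [|i w IHw] /=.
  by move=> _; split; [exists id | | rewrite disp_id].
case/andP=> /andP[n_gt1 _] /IHw[bij ss le]; split.
- exact: bij_comp (refl_bij i n_gt1) bij.
- by move=> x /=; rewrite ss refl_shifting.
apply: le_trans (refl_disp i n_gt1 ss (bij_inj bij)) _.
by rewrite (_ : (size w).+1.*2%:Z = (size w).*2%:Z + 2) ?lerD2r //; lia.
Qed.

Lemma avoids321_word s : affine_perm n s -> avoids321 s ->
  exists w, [/\ is_word n w, word_prod n w = s & (size w).*2%:Z = disp s].
Proof.
move: s; apply: avoids321_ind; first by exists [::]; rewrite disp_id.
move=> i s n_gt1 ltin sa _ asc [w [wn ws szw]]; exists (rcons w i).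
have /affine_permP[_ ss _] := sa.
split; first by rewrite /is_word all_rcons -/(is_word n w) wn n_gt1 ltin.
  by rewrite word_prod_rcons ws.
by rewrite disp_refl // -szw size_rcons; lia.
Qed.

(** Each letter adds at most 2 to [disp], which bounds the length below, and the word of
    [avoids321_word] attains this bound. *)
Lemma coxeter_lengthP s k : affine_perm n s -> avoids321 s ->
  coxeter_length n s k <-> disp s = k.*2%:Z.
Proof.
move=> sa s321; have [w [wn ws szw]] := avoids321_word sa s321.
have lower v : is_word n v -> word_prod n v = s -> (size w <= size v)%N.
  by move=> /word_prodP[_ _ le] vs; rewrite vs in le; lia.
split=> [[[v [vn vs <-]] min]|dk].
  by have := lower v vn vs; have := min w wn ws; lia.
have <- : size w = k by lia.
by split; [exists w | exact: lower].
Qed.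

End Length.

(** * Permutations and walks *)

Section Coding.
Variable n' : nat.
Local Notation n := n'.+1.
Implicit Types (x y z : int) (s A B : int -> int) (a b : int -> bool).
Local Notation wsum := (@wsum n' _).
Local Notation disp := (disp n').
Local Notation "x =%n y" := (x == y %[mod n%:Z])%Z (at level 70).

Definition counts a A := forall x, A (x + 1) = A x + (a x : nat)%:Z.

Lemma counts_exists a : exists A, counts a A.
Proof.
exists (fun x => match x with
  | Posz m => \sum_(j < m) (a j%:Z : nat)%:Z
  | Negz m => - \sum_(j < m.+1) (a (Negz j) : nat)%:Z end).
case=> [m|[|m]]; first by rewrite addrC -intS big_ord_recr.
  by rewrite /= big_ord0 big_ord1 addNr.
have -> : Negz m.+1 + 1 = Negz m by lia.
by rewrite [in RHS]big_ord_recr /= opprD addrNK.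
Qed.

Lemma counts_lt a A x y : counts a A -> x < y ->
  A x + (a x : nat)%:Z <= A y /\ x - A x + (~~ a x : nat)%:Z <= y - A y.
Proof.
move=> aA lt_xy; have [m ->] : exists m : nat, y = x + 1 + m%:Z.
  by exists (absz (y - x - 1)%R); lia.
elim: m => [|m [IH1 IH2]]; first by rewrite addr0 aA; case: (a x); lia.
have -> : x + 1 + m.+1%:Z = x + 1 + m%:Z + 1 by lia.
by rewrite aA; case: (a (x + 1 + m%:Z)) => /=; lia.
Qed.

Lemma counts_le a A x y : counts a A -> x <= y ->
  A x <= A y /\ x - A x <= y - A y.
Proof.
move=> aA; rewrite le_eqVlt => /predU1P[->//|/(counts_lt aA)].
by case: (a x) => /=; lia.
Qed.

(* [a] marks the positions, and [b] the values, of the upper part of [s]; [A] and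
   [B] rank them, and [x - A x] and [x - B x] rank their complements.  So [s]
   matches positions and values of equal rank within each part.  The label of a
   fixed point is arbitrary, which makes the notion stable under [coded_refl]. *)
Record coded s a b A B : Prop := Coded {
  coded_A : counts a A;
  coded_B : counts b B;
  coded_comp : forall x, b (s x) = a x;
  coded_up : forall x, a x -> x <= s x /\ B (s x) = A x;
  coded_down : forall x, ~~ a x -> s x <= x /\ s x - B (s x) = x - A x;
  coded_ge : forall x, B x <= A x;
  coded_per : periodic n' (fun x => A x - B x)
}.

Lemma coded_id a A : counts a A -> coded idfun a a A A.
Proof. by move=> aA; split=> // x; rewrite !subrr. Qed.

(** [s] is increasing on each part, and two of any three positions lie in the same part. *)
Lemma coded_avoids321 s a b A B : coded s a b A B -> avoids321 s.
Proof.
move=> c [x [y [z [xy yz sxy syz]]]].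
have inc u v : u < v -> a u = a v -> s u < s v.
  move=> uv auv; have [hA1 hA2] := counts_lt (coded_A c) uv.
  rewrite ltNge; apply/negP; rewrite le_eqVlt => /predU1P[svu|svu].
    case au : (a u); move: auv (au); rewrite au => /esym av _.
      have [_ Bu] := coded_up c au; have [_ Bv] := coded_up c av.
      by move: hA1; rewrite -Bu -Bv svu au /=; lia.
    have [_ Bu] := coded_down c (negbT au).
    have [_ Bv] := coded_down c (negbT av).
    by move: hA2; rewrite -Bu -Bv svu au /=; lia.
  have [hB1 hB2] := counts_lt (coded_B c) svu.
  case au : (a u); move: auv (au); rewrite au => /esym av _.
    have [_ Bu] := coded_up c au; have [_ Bv] := coded_up c av.
    by move: hA1 hB1; rewrite au /=; lia.
  have [_ Bu] := coded_down c (negbT au).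
  have [_ Bv] := coded_down c (negbT av).
  by move: hA2 hB2; rewrite au /=; lia.
have [axy|axy] := eqVneq (a x) (a y); first by have := inc _ _ xy axy; lia.
have [ayz|ayz] := eqVneq (a y) (a z); first by have := inc _ _ yz ayz; lia.
have axz : a x = a z by move: axy ayz; case: (a x) (a y) (a z) => [] [] [].
by have := inc _ _ (lt_trans xy yz) axz; lia.
Qed.

Section CodedRefl.
Variable i : nat.
Hypothesis n_gt1 : (1 < n)%N.
Local Notation si := (simple_refl n i).

(** An upper label moves from [x + 1] down to [x], which raises the rank [A] by one at [x + 1] only.
    The values keep their labels, hence [b] and [B] stay. *)
Lemma coded_refl s a b A B : coded s a b A B ->
    (forall x, x =%n i%:Z -> ~~ a x /\ a (x + 1)) ->
  coded (s \o si) (a \o si) b (fun x => A x + (x =%n i.+1%:Z : nat)%:Z) B.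
Proof.
move=> c ai; have [cA cB cab cup cdn cge cper] := c; split=> //.
- move=> x /=; rewrite class_succ // cA.
  case: (reflP i n_gt1 x) => [xi _|_ xi|_ _] /=; last by lia.
    by have [/negPf -> ->] := ai _ xi; lia.
  by have [/negPf -> ] := ai _ xi; rewrite subrK => ->; lia.
- by move=> x /=; rewrite cab.
- move=> x /=; case: (reflP i n_gt1 x) => [xi _|_ xi|_ _] /=.
  + move=> ax; have [le ->] := cup _ ax; have [/negPf nax _] := ai _ xi.
    by rewrite cA nax; split; lia.
  + by have [/negPf ->] := ai _ xi.
  + by rewrite addr0; exact: cup.
- move=> x /=; case: (reflP i n_gt1 x) => [xi _|_ xi|_ _] /=.
  + by have [_ ->] := ai _ xi.
  + move=> ax; have [le ->] := cdn _ ax.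
    by have := cA (x - 1); rewrite (negPf ax) subrK; lia.
  + by rewrite addr0; exact: cdn.
- by move=> x; have := cge x; lia.
- by move=> x; have := cper x; rewrite modzDr; lia.
Qed.

End CodedRefl.

(** All labelings of the fixed points are covered, because the labels of [s \o si] carried over to
    [s] follow no uniform rule at the fixed points of [s]. *)
Lemma coded_exists s : affine_perm n s -> avoids321 s ->
  forall a, periodic n' a ->
    (forall x, x < s x -> a x) -> (forall x, s x < x -> ~~ a x) ->
  exists b A B, coded s a b A B /\ disp s = wsum (fun x => A x - B x) *+ 2.
Proof.
move: s; apply: avoids321_ind => [a _ _ _|].
  have [A aA] := counts_exists a; exists a, A, A.
  split; first exact: coded_id.
  rewrite disp_id (@eq_wsum _ _ _ (fun=> 0)) => [|x]; last by rewrite subrr.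
  by rewrite /wsum big1 ?mul0rn.
move=> i s n_gt1 _ sa _ asc IHs a pera aup adn.
pose a' := a \o simple_refl n i.
have ai x : x =%n i%:Z -> ~~ a' x /\ a' (x + 1).
  move=> xi; have [lo hi] := asc x xi; rewrite /a' /=.
  case: (reflP i n_gt1 x) xi => // xi xi' _; split.
    apply: adn => /=; case: (reflP i n_gt1 (x + 1)) xi' => // *.
    by rewrite addrK; lia.
  case: (reflP i n_gt1 (x + 1)) xi' => // _ _ _; rewrite addrK.
  by apply: aup => /=; case: (reflP i n_gt1 x) xi => // *; lia.
have [|x xs|x xs|b [A [B [c dE]]]] := IHs a'.
- by move=> x; rewrite /a' /= refl_shifting.
- apply: aup; rewrite /= reflK //.
  case: (reflP i n_gt1 x) => // xi *; last by lia.
  by have := asc _ xi; lia.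
- apply: adn; rewrite /= reflK //.
  case: (reflP i n_gt1 x) => // [xi xi'|xi xi']; first by lia.
  by have := asc _ xi'; rewrite subrK; lia.
exists b, (fun x => A x + (x =%n i.+1%:Z : nat)%:Z), B; split.
  have aE : a = a' \o simple_refl n i.
    by apply: funext => x; rewrite /a' /= reflK.
  by rewrite aE; exact: coded_refl.
have /affine_permP[_ ss _] := sa; rewrite disp_refl // dE.
have -> : wsum (fun x => A x + (x =%n i.+1%:Z : nat)%:Z - B x) =
    wsum (fun x => A x - B x) + 1.
  by rewrite -(wsum_class n' i.+1%:Z) -wsumD; apply: eq_wsum => x; ring.
by ring.
Qed.

End Coding.

(** * From walks back to permutations *)

Section Paths.
Variable n' : nat.
Local Notation n := n'.+1.
Implicit Types (x y z : int) (s A B h : int -> int) (a b : int -> bool).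
Local Notation wsum := (@wsum n' _).
Local Notation disp := (disp n').
Local Notation "x =%n y" := (x == y %[mod n%:Z])%Z (at level 70).

Definition steps a b h :=
  forall x, h (x + 1) = h x + (a x : nat)%:Z - (b x : nat)%:Z.

(** Without a peak, an upper label followed by a positive height would be followed by upper labels
    forever. So the height is 0 after each upper label; as only these can raise it, it is 0
    everywhere. *)
Lemma steps_peak a b h : periodic n' a -> periodic n' h -> steps a b h ->
    (forall x, 0 <= h x) -> (exists x, a x) -> (exists x, ~~ a x) ->
    (exists x, h x != 0) ->
  exists x, [/\ a x, ~~ a (x + 1) & 1 <= h (x + 1)].
Proof.
move=> pera perh st h0 [x1 ax1] [x2 ax2] [x3 hx3].
apply: contrapT => /forallNP nopeak.
have peak x : a x -> 1 <= h (x + 1) -> a (x + 1).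
  by move=> ax hx; apply: contrapT => /negP nax; case: (nopeak x).
have [[x /andP[ax hx]]|noup] := pselect (exists x, a x && (1 <= h (x + 1))).
  suff /andP[] : a x2 && (1 <= h (x2 + 1)) by rewrite (negPf ax2).
  apply: (@periodic_ind n' (fun z => a z && (1 <= h (z + 1))) _ _ x).
  - by move=> z; rewrite pera addrAC perh.
  - move=> z /andP[az hz]; have az1 := peak _ az hz.
    by rewrite az1 st az1; case: (b _) => /=; lia.
  - by rewrite ax.
have up x : a x -> h (x + 1) < 1.
  by move=> ax; rewrite ltNge; apply/negP => hx; apply: noup; exists x; rewrite ax.
suff hx1 : 1 <= h (x1 + 1) by have := up _ ax1; lia.
rewrite leNgt; apply/negP => hx1.
suff : h x3 < 1 by have := h0 x3; lia.
apply: (@periodic_ind n' (fun z => h z < 1) _ _ (x1 + 1)) => //.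
  by move=> z; rewrite perh.
move=> z hz; case az : (a z); first exact: up.
by rewrite st az; case: (b z) => /=; lia.
Qed.

(** Induction on the area: lowering the walk at a peak exchanges two labels of positions, and
    composing with the reflection restores it. The exchange keeps both labels present. *)
Lemma steps_coded a b h : periodic n' a -> periodic n' h -> steps a b h ->
    (forall x, 0 <= h x) ->
    (forall x, h x = 0) \/ (exists x, a x) /\ (exists x, ~~ a x) ->
  exists s A B, [/\ affine_perm n s, coded n' s a b A B,
    forall x, h x = A x - B x & disp s = wsum h *+ 2].
Proof.
have [k] := ubnP (absz (wsum h)); elim: k a h => // k IHk a h lt_k.
move=> pera perh st h0 nconst.
have [h_0|h_n0] := pselect (forall x, h x = 0).
  have ab : b = a.
    apply: funext => x; have := st x; rewrite !h_0.
    by case: (a x) (b x) => [] [] //=; lia.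
  have [A aA] := counts_exists a; exists idfun, A, A; rewrite ab; split.
  - exact: affine_perm_id.
  - exact: coded_id.
  - by move=> x; rewrite subrr.
  - by rewrite disp_id (@eq_wsum _ _ _ (fun=> 0)) // /wsum big1 ?mul0rn.
have [ax nax] : (exists x, a x) /\ (exists x, ~~ a x) by case: nconst.
have hn0 : exists x, h x != 0.
  by apply: contrapT => /forallNP hN; apply: h_n0 => x; apply/eqP/negPn/negP.
have [x0 [ax0 nax0 hx0]] := steps_peak pera perh st h0 ax nax hn0.
have n_gt1 : (1 < n)%N.
  rewrite ltnNge; apply/negP => n1; have n0 : n' = 0%N by lia.
  by move: (pera x0) nax0; rewrite n0 => ->; rewrite ax0.
pose i := absz (x0 %% n%:Z)%Z.
have clsE x : (x =%n i%:Z) = (x =%n x0).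
  by rewrite /i gez0_abs ?modz_ge0 // modz_mod.
have pk x : x =%n i%:Z -> [/\ a x, ~~ a (x + 1) & 1 <= h (x + 1)].
  rewrite clsE => /eqmodP[j ->].
  by rewrite addrAC !(periodicZ pera) (periodicZ perh).
pose a' := a \o simple_refl n i.
pose h' x := h x - (x =%n i.+1%:Z : nat)%:Z.
have hE : wsum h = wsum h' + 1.
  by rewrite -(wsum_class n' i.+1%:Z) -wsumD; apply: eq_wsum => x; rewrite subrK.
have h'0 x : 0 <= h' x.
  rewrite /h' -{2}(subrK 1 x) class_succ //.
  case xi : (x - 1 =%n i%:Z) => /=; last by rewrite subr0.
  by have [_ _] := pk _ xi; rewrite subrK; lia.
have a'pk x : x =%n i%:Z -> ~~ a' x /\ a' (x + 1).
  move=> xi; have [ax1 nax1 _] := pk _ xi; rewrite /a' /=.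
  case: (reflP i n_gt1 x) xi => // _ xi' _; split=> //.
  by case: (reflP i n_gt1 (x + 1)) xi' => // *; rewrite addrK.
have wh0 : 0 <= wsum h' by apply: sumr_ge0 => j _; exact: h'0.
have [||||||s [A [B [sa c h'E dE]]]] := IHk a' h'.
- lia.
- by move=> x; rewrite /a' /= refl_shifting.
- by move=> x; rewrite /h' perh modzDr.
- move=> x; rewrite /h' /a' /= st class_succ //.
  case: (reflP i n_gt1 x) => [xi _|_ xi|_ _] /=; last by lia.
    by have [-> /negPf -> _] := pk _ xi; lia.
  by have [-> + _] := pk _ xi; rewrite subrK => /negPf ->; lia.
- exact: h'0.
- right; have := a'pk x0; rewrite clsE eqxx => -[] // nax0' ax0'.
  by split; [exists (x0 + 1) | exists x0].
have aE : a = a' \o simple_refl n i by apply: funext => x; rewrite /a' /= reflK.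
exists (s \o simple_refl n i), (fun x => A x + (x =%n i.+1%:Z : nat)%:Z), B; split.
- exact: refl_affine.
- by rewrite aE; exact: coded_refl.
- by move=> x; have := h'E x; rewrite /h'; lia.
have /affine_permP[_ ss _] := sa; rewrite disp_refl //; first by rewrite dE hE; ring.
move=> x /a'pk[nax' ax'].
by have [] := coded_down c nax'; have [] := coded_up c ax'.
Qed.

(** Labels and heights fix [A] and [B] up to a common constant, and a value is determined by its
    part and its rank there. *)
Lemma coded_uniq s1 s2 a b A1 B1 A2 B2 :
    coded n' s1 a b A1 B1 -> coded n' s2 a b A2 B2 ->
    (forall x, A1 x - B1 x = A2 x - B2 x) ->
  s1 = s2.
Proof.
move=> c1 c2 hE; pose c := A2 0 - A1 0.
have A2E x : A2 x = A1 x + c.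
  pose d x := A2 x - A1 x; suff : d x = d 0 by rewrite /d /c; lia.
  have dS z : d (z + 1) = d z by rewrite /d (coded_A c1) (coded_A c2); lia.
  have up (m : nat) z : d (z + m%:Z) = d z.
    elim: m z => [|m IHm] z; first by rewrite addr0.
    by rewrite intS addrA IHm dS.
  case: (intP x) => // m; first by rewrite -(up m.+1 0) add0r.
  by rewrite -(up m.+1 (- _)) addNr.
have B2E x : B2 x = B1 x + c by have := hE x; rewrite A2E; lia.
apply: funext => x.
have inj y z : b y = b z -> b y -> B1 y = B1 z -> y = z.
  move=> byz yb Byz; have [lt_yz|lt_zy|//] := ltgtP y z.
    by have [] := counts_lt (coded_B c1) lt_yz; rewrite yb; lia.
  by have [] := counts_lt (coded_B c1) lt_zy; rewrite -byz yb; lia.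
have inj' y z : b y = b z -> ~~ b y -> y - B1 y = z - B1 z -> y = z.
  move=> byz yb Byz; have [lt_yz|lt_zy|//] := ltgtP y z.
    by have [_] := counts_lt (coded_B c1) lt_yz; rewrite yb; lia.
  by have [_] := counts_lt (coded_B c1) lt_zy; rewrite -byz yb; lia.
have bE : b (s1 x) = b (s2 x) by rewrite (coded_comp c1) (coded_comp c2).
case ax : (a x).
  apply: inj => //; first by rewrite (coded_comp c1).
  have [_] := coded_up c1 ax; have [_] := coded_up c2 ax.
  by rewrite A2E B2E; lia.
have nax := negbT ax; apply: inj' => //; first by rewrite (coded_comp c1).
have [_] := coded_down c1 nax; have [_] := coded_down c2 nax.
by rewrite A2E B2E; lia.
Qed.

End Paths.

Lemma card_fset_set_rel (T : choiceType) (C : finType) (Y : {set C})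
    (X : set T) (Q : C -> T -> Prop) : finite_set X ->
    (forall c, c \in Y -> exists2 t, X t & Q c t) ->
    (forall t, X t -> exists2 c, c \in Y & Q c t) ->
    (forall c t t', Q c t -> Q c t' -> t = t') ->
    (forall c c' t, c \in Y -> c' \in Y -> X t -> Q c t -> Q c' t -> c = c') ->
  #|` fset_set X|%fset = #|Y|.
Proof.
move=> finX QY QX Qfun Qinj; case: (set_0Vmem Y) => [Y0|[c0 Yc0]].
  have -> : X = set0.
    by rewrite -subset0 => t /QX[c]; rewrite Y0 inE.
  by rewrite fset_set0 cardfs0 Y0 cards0.
have [t0 _ _] := QY c0 Yc0.
have /choice[F FP] : forall c, exists t, c \in Y -> X t /\ Q c t.
  move=> c; have [/QY[t Xt Qt]|] := boolP (c \in Y); last by exists t0.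
  by exists t.
rewrite cardE -(size_map F); apply: perm_size; apply: uniq_perm.
- exact: fset_uniq.
- rewrite map_inj_in_uniq ?enum_uniq // => c c'; rewrite !mem_enum => Yc Yc' FF.
  have [XF QF] := FP c Yc; have [_ QF'] := FP c' Yc'.
  by apply: (Qinj c c' (F c)) => //; rewrite FF.
move=> t; rewrite in_fset_set //; apply/idP/mapP.
  rewrite inE => Xt; have [c Yc Qt] := QX t Xt; exists c; first by rewrite mem_enum.
  by have [_ QF] := FP c Yc; exact: Qfun Qt QF.
by move=> [c]; rewrite mem_enum => Yc ->; rewrite inE; have [] := FP c Yc.
Qed.

(** * Finite codes of periodic walks *)

Section Codes.
Variables n' K : nat.
Local Notation n := n'.+1.
Implicit Types (x y z : int) (s A B h : int -> int) (a b : int -> bool).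
Local Notation wsum := (@wsum n' _).
Local Notation disp := (disp n').

(** One window of a walk: the heights, then the labels of each point as a position and as a value.
    The bound [K] makes the type finite and gives the size of the transfer matrix. *)
Definition code : finType :=
  ({ffun 'I_n -> 'I_K.+1} * {ffun 'I_n -> bool * bool})%type.
Implicit Type c : code.

(* The last condition leaves only the step [(true, true)] at height 0, the one
   of fixed points. *)
Definition step_ok (h : nat) (ab : bool * bool) (h' : nat) : bool :=
  (h + ab.1 == h' + ab.2)%N && [|| ab.1, ab.2 | (0 < h)%N].

Definition valid_code c := [forall j, step_ok (c.1 j) (c.2 j) (c.1 (ordS j))].

Definition code_area c := (\sum_(j < n) c.1 j)%N.

(* On valid codes, these are the walks of constant positive height whose steps
   are all equal: they encode translations, whose displacements have nonzero
   sum. *)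
Definition flat_code c :=
  (0 < c.1 ord0)%N && [exists ab, (ab.1 == ab.2) && [forall j, c.2 j == ab]].

Definition code_a c x := (c.2 (res n' x)).1.
Definition code_b c x := (c.2 (res n' x)).2.
Definition code_h c x := (c.1 (res n' x))%:Z.

Lemma res_shift x : res n' (x + n%:Z) = res n' x.
Proof. by apply/eqP; rewrite -eqmod_res modzDr. Qed.

Lemma resS x : res n' (x + 1) = ordS (res n' x).
Proof.
have [k xE] := resP n' x; apply: (@res_unique _ _ _ (k + ((res n' x).+1 %/ n)%N%:Z)).
have := divn_eq (res n' x).+1 n; rewrite /= {1}xE.
by set q := (_ %/ _)%N; set r := (_ %% _)%N; lia.
Qed.

Lemma code_a_per c : periodic n' (code_a c).
Proof. by move=> x; rewrite /code_a res_shift. Qed.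

Lemma code_h_per c : periodic n' (code_h c).
Proof. by move=> x; rewrite /code_h res_shift. Qed.

Lemma code_steps c : valid_code c -> steps (code_a c) (code_b c) (code_h c).
Proof.
move=> /forallP vc x; have /andP[/eqP e _] := vc (res n' x).
apply/eqP; rewrite eq_sym subr_eq /code_a /code_b /code_h resS.
by rewrite -!PoszD e.
Qed.

Lemma wsum_code c : wsum (code_h c) = (code_area c)%:Z.
Proof.
rewrite /code_area /wsum (big_morph Posz PoszD erefl).
by apply: eq_bigr => j _; rewrite /code_h resE.
Qed.

Definition codes s c := affine_perm n s /\ exists A B,
  coded n' s (code_a c) (code_b c) A B /\ forall x, code_h c x = A x - B x.

Lemma codes_fun c s s' : codes s c -> codes s' c -> s = s'.
Proof.
move=> [_ [A [B [cAB hE]]]] [_ [A' [B' [cAB' hE']]]].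
by apply: coded_uniq cAB cAB' _ => x; rewrite -hE -hE'.
Qed.

Lemma codes_avoids s c : codes s c -> avoids321 s.
Proof. by move=> [_ [A [B [/coded_avoids321]]]]. Qed.

(** A fixed point cannot be labeled lower: its height would be 0 with both labels false, which
    [step_ok] excludes. *)
Lemma codes_a s c : valid_code c -> codes s c ->
  forall x, code_a c x = (x <= s x).
Proof.
move=> /forallP vc [_ [A [B [cAB hE]]]] x; case ax : (code_a c x).
  by have [->] := coded_up cAB ax.
have [le e] := coded_down cAB (negbT ax); apply/esym/negbTE; apply/negP => le'.
have sx : s x = x by lia.
have bx : code_b c x = false by rewrite -{1}sx (coded_comp cAB).
move: e; rewrite sx => /addrI/oppr_inj e.
have /andP[_] := vc (res n' x); have := hE x.
rewrite e subrr /code_h => /eqP; rewrite eqz_nat => /eqP ->.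
by rewrite -[(c.2 _).1]/(code_a c x) -[(c.2 _).2]/(code_b c x) ax bx.
Qed.

(** [s] determines the labels of positions by [codes_a], then those of values. The heights follow up
    to a constant, which is 0 because the areas agree. *)
Lemma codes_inj s c c' : valid_code c -> valid_code c' ->
  code_area c = code_area c' -> codes s c -> codes s c' -> c = c'.
Proof.
move=> vc vc' areaE sc sc'.
have aE x : code_a c x = code_a c' x by rewrite (codes_a vc sc) (codes_a vc' sc').
have [sa [A [B [cAB hE]]]] := sc; have [_ [A' [B' [cAB' hE']]]] := sc'.
have bE x : code_b c x = code_b c' x.
  have /affine_permP[[g _ gK] _ _] := sa.
  by rewrite -[x]gK (coded_comp cAB) (coded_comp cAB') aE.
have hdiff x : code_h c x - code_h c' x = code_h c 0 - code_h c' 0.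
  apply/eqP; apply: (@periodic_ind n' (fun x => _ x - _ x == _) _ _ 0) => // z.
    by rewrite !code_h_per.
  by rewrite (code_steps vc) (code_steps vc') aE bE => /eqP <-; apply/eqP; ring.
have : wsum (fun x => code_h c x - code_h c' x) = 0.
  by rewrite wsumD wsumN !wsum_code areaE subrr.
rewrite (eq_wsum _ hdiff) /wsum sumr_const card_ord => /eqP.
rewrite mulrn_eq0 /= => /eqP d0.
case: c c' {vc vc' areaE sc sc' cAB cAB' hE hE'} aE bE hdiff d0 => [f g] [f' g'].
move=> aE bE hdiff d0; congr pair; apply/ffunP => j.
  apply: val_inj; have := hdiff j.+1%:Z; rewrite d0 /code_h resE /=; lia.
have := aE j.+1%:Z; have := bE j.+1%:Z; rewrite /code_a /code_b !resE /=.
by case: (g j) (g' j) => [? ?] [? ?] /= -> ->.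
Qed.

Lemma code_const (e : bool) c : valid_code c -> (forall x, code_a c x = e) ->
  (forall x y, code_h c x = code_h c y) /\ (forall x, code_b c x = e).
Proof.
move=> vc aE; have st := code_steps vc; have perh := code_h_per c.
have hE x y : code_h c x = code_h c y.
  have le u v : if e then code_h c u <= code_h c v else code_h c v <= code_h c u.
    apply: (@periodic_ind n'
      (fun v => if e then code_h c u <= code_h c v else code_h c v <= code_h c u)
      _ _ u); last by rewrite lexx if_same.
      by move=> z; rewrite perh.
    by move=> z; rewrite st aE; case: (e); case: (code_b c z) => /=; lia.
  by apply/eqP; rewrite eq_le; move: (le x y) (le y x); case: (e) => -> ->.
split=> // x; have := st x; rewrite aE (hE (x + 1) x).
by case: (e) (code_b c x) => [] [] //=; lia.
Qed.

Lemma code_a_nconst c : valid_code c -> ~~ flat_code c ->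
  (forall x, code_h c x = 0) \/
  (exists x, code_a c x) /\ (exists x, ~~ code_a c x).
Proof.
move=> vc nflat; have const e : (forall x, code_a c x = e) ->
    forall x, code_h c x = 0.
  move=> aE x; have [hE bE] := code_const vc aE; rewrite (hE x 1).
  have [h1|h1] := posnP (c.1 ord0).
    by rewrite /code_h (resE (ord0 : 'I_n)) h1.
  case/negP: nflat; rewrite /flat_code h1; apply/existsP; exists (e, e).
  rewrite eqxx; apply/forallP => j; have := aE j.+1%:Z; have := bE j.+1%:Z.
  by rewrite /code_a /code_b resE; case: (c.2 j) => [? ?] /= -> ->.
have [aT|/forallNP aF] := pselect (exists x, code_a c x); last first.
  by left; apply: (const false) => x; apply/negP/aF.
have [aF|/forallNP aF] := pselect (exists x, ~~ code_a c x); first by right.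
by left; apply: (const true) => x; apply/negPn/negP/aF.
Qed.

Lemma codes_exists c : valid_code c -> ~~ flat_code c ->
  exists2 s, codes s c & disp s = (code_area c).*2%:Z.
Proof.
move=> vc nflat; have [|s [A [B [sa cAB hE dE]]]] := steps_coded (code_a_per c)
  (code_h_per c) (code_steps vc) _ (code_a_nconst vc nflat); first by [].
exists s; first by split=> //; exists A, B.
by rewrite dE wsum_code mulr2n -addnn PoszD.
Qed.

Lemma affine_perm_exists_le s : affine_perm n s -> exists x, x <= s x.
Proof.
move=> sa; apply: contrapT => /forallNP lt; have : 0 <= -1 :> int; last by [].
by apply: affine_perm_le sa _ => x x0; have := lt x; lia.
Qed.

Lemma affine_perm_ge_id s : affine_perm n s -> (forall x, x <= s x) -> s = idfun.
Proof.
move=> sa le; have /affine_permP[bij ss sum] := sa; apply: funext => x /=.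
have per : periodic n' (fun x => s x - x) by move=> y; rewrite ss; ring.
have ge0 (j : 'I_n) : true -> 0 <= s j.+1%:Z - j.+1%:Z by rewrite subr_ge0 le.
have := sum; rewrite /wsum => /eqP; rewrite psumr_eq0 // => /allP /= all0.
have := all0 (res n' x) (mem_index_enum _).
by rewrite -(periodic_res per) subr_eq0 => /eqP.
Qed.

(** The labeling [x <= s x] is the one that valid codes impose. The heights add up to half of
    [disp s], so none exceeds [K]. *)
Lemma codes_total s : affine_perm n s -> avoids321 s ->
    disp s <= K.*2%:Z ->
  exists c, [/\ valid_code c, ~~ flat_code c & codes s c].
Proof.
move=> sa s321 dK; have /affine_permP[bij ss sum] := sa.
pose a x := x <= s x.
have pera : periodic n' a by move=> x; rewrite /a ss lerD2r.
have [|x|b [A [B [cAB dE]]]] := coded_exists sa s321 pera; first by move=> x /ltW.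
  by rewrite -ltNge.
have perb : periodic n' b.
  move=> y; case: bij => g _ gK; rewrite -[y]gK -ss.
  by rewrite !(coded_comp cAB) pera.
pose h x := A x - B x.
have perh : periodic n' h := coded_per cAB.
have h0 x : 0 <= h x by rewrite subr_ge0 (coded_ge cAB).
have hK x : h x <= K%:Z.
  have : h x <= wsum h.
    rewrite /wsum (bigD1 (res n' x)) //= -(periodic_res perh) lerDl.
    by apply: sumr_ge0 => j _; exact: h0.
  move: dK; rewrite dE -/h mulr2n; lia.
pose c : code := ([ffun j : 'I_n => inord (absz (h j.+1%:Z))],
                  [ffun j : 'I_n => (a j.+1%:Z, b j.+1%:Z)]).
have hE x : code_h c x = h x.
  rewrite /code_h ffunE -(periodic_res perh) inordK; first by rewrite gez0_abs.
  by have := hK x; have := h0 x; lia.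
have aE x : code_a c x = a x by rewrite /code_a ffunE /= -(periodic_res pera).
have bE x : code_b c x = b x by rewrite /code_b ffunE /= -(periodic_res perb).
have sc : codes s c.
  split=> //; exists A, B; split=> //.
  by rewrite (funext aE) (funext bE).
have st x : h (x + 1) + (b x : nat)%:Z = h x + (a x : nat)%:Z.
  by rewrite /h (coded_A cAB) (coded_B cAB); ring.
have vc : valid_code c.
  apply/forallP => j; rewrite -(resE j) -resS; set x : int := j.+1%:Z.
  apply/andP; split.
    rewrite -eqz_nat !PoszD -/(code_h c x) -/(code_h c (x + 1)).
    by rewrite -/(code_a c x) -/(code_b c x) !hE aE bE st.
  (* If both labels are false, [s x < x], and comparing the lower ranks of [s x] and [x] among
     values gives [h x > 0]. *)
  rewrite -ltz_nat -/(code_h c x) -/(code_a c x) -/(code_b c x) hE aE bE.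
  case ax : (a x) => //; case bx : (b x) => //=.
  rewrite lt_neqAle h0 andbT; apply/negP => /eqP hx.
  have [le e] := coded_down cAB (negbT ax).
  have sx : s x < x by rewrite ltNge [_ <= _]ax.
  have [_] := counts_lt (coded_B cAB) sx.
  by rewrite (coded_comp cAB) ax /=; move: hx; rewrite /h; lia.
(* In a flat code all labels agree: all upper makes [s] the identity, with heights 0, and all lower
   contradicts [affine_perm_exists_le]. *)
exists c; split=> //; apply/negP => /andP[h1 /existsP[[e e'] /andP[/eqP /= <-]]].
move=> /forallP const; have {}const x : a x = e.
  by rewrite -aE /code_a; have /eqP -> := const (res n' x).
case: e const => const.
  have sid := affine_perm_ge_id sa const.
  have [_] := coded_up cAB (const 1); rewrite sid /= => BA1.
  have := hE 1; rewrite /h BA1 subrr /code_h (resE (ord0 : 'I_n)).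
  by move: h1; case: (c.1 ord0 : nat).
have [x lex] := affine_perm_exists_le sa.
by have := const x; rewrite /a lex.
Qed.

Lemma codes_disp s c : valid_code c -> ~~ flat_code c -> codes s c ->
  disp s = (code_area c).*2%:Z.
Proof.
by move=> vc nflat sc; have [t /(codes_fun sc) ->] := codes_exists vc nflat.
Qed.

End Codes.

(** * Counting permutations by length *)

Section Cardinals.
Variables n' K : nat.
Local Notation n := n'.+1.
Local Notation code := (code n' K).
Implicit Types (x y z : int) (s : int -> int) (c : code) (k : nat).

Lemma finite_perm_le0 s x : finite_perm n s -> (s x <= 0) = (x <= 0).
Proof.
move=> [/affine_permP[_ ss _] [p sp]]; have [l ->] := resP n' x.
rewrite shiftingZ // sp; have := ltn_ord (res n' x); have := ltn_ord (p (res n' x)).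
move: (p _ : nat) (res n' x : nat) => u v ltu ltv.
by have [l0|l0] := lerP 0 l; apply/idP/idP; nia.
Qed.

(** By translation, [s] also preserves the integers up to [n], and therefore the window. *)
Lemma finite_permP s : affine_perm n s -> (forall x, (s x <= 0) = (x <= 0)) ->
  finite_perm n s.
Proof.
move=> sa s0; split=> //; have /affine_permP[bij ss _] := sa.
pose r (j : 'I_n) := res n' (s j.+1%:Z).
have rE (j : 'I_n) : s j.+1%:Z = (r j).+1%:Z.
  have [l sE] := resP n' (s j.+1%:Z); rewrite -/(r j) in sE.
  have lo : 0 < s j.+1%:Z by rewrite ltNge s0.
  have hi : s j.+1%:Z <= n%:Z.
    have := s0 (j.+1%:Z + (-1) * n%:Z); rewrite shiftingZ //.
    by have := ltn_ord j; lia.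
  have := ltn_ord (r j); move: lo hi sE.
  by have [||->] := ltgtP l 0; nia.
have r_inj : injective r.
  move=> i j rij; have : s i.+1%:Z = s j.+1%:Z by rewrite !rE rij.
  by move=> /(bij_inj bij)[/val_inj].
by exists (perm r_inj) => j; rewrite permE.
Qed.

(** The height at 1 is the number of positions [y <= 0] with [1 <= s y]. *)
Lemma codes_finite s c : valid_code c -> ~~ flat_code c -> codes s c ->
  finite_perm n s <-> c.1 ord0 = ord0.
Proof.
move=> vc nflat sc; have [sa [A [B [cAB hE]]]] := sc.
have h1E : A 1 - B 1 = (c.1 ord0)%:Z by rewrite -hE /code_h (resE (ord0 : 'I_n)).
split=> [sf|c0].
  apply/val_inj/eqP; rewrite /= -leqn0 leqNgt; apply/negP => c0.
  have [x ax] : exists x, code_a c x.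
    by have [x lex] := affine_perm_exists_le sa; exists x; rewrite (codes_a vc sc).
  have bper : periodic n' (code_b c) by move=> y; rewrite /code_b res_shift.
  have ex : exists m : nat, code_b c (1 + m%:Z).
    exists (res n' (s x)); rewrite -intS -(periodic_res bper).
    by rewrite (coded_comp cAB).
  (* The first upper value [1 + m] from 1 on has rank [B 1]. At positive height this is less than
     [A 1], so its preimage would be at most 0. *)
  case: (ex_minnP ex) => m bm min.
  have Bm : B (1 + m%:Z) = B 1.
    have le_m : (m <= m)%N by []; move: {1 3}m le_m; elim=> [|u IHu] le_um.
      by rewrite addr0.
    rewrite intS [1 + u%:Z]addrC addrA (coded_B cAB) IHu ?(ltnW le_um) //.
    case bu : (code_b c _); last by rewrite addr0.
    by have := min u bu; lia.
  have /affine_permP[[g gK Kg] _ _] := sa.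
  pose y := g (1 + m%:Z); have sy : s y = 1 + m%:Z by rewrite Kg.
  have ay : code_a c y by rewrite -(coded_comp cAB) sy.
  have [_] := coded_up cAB ay; rewrite sy Bm => BA.
  have := finite_perm_le0 y sf; rewrite sy => y0.
  have y1 : 1 <= y by rewrite -[1]add0r lezD1 ltNge -y0 -ltNge; lia.
  have [+ _] := counts_le (coded_A cAB) y1; rewrite -BA -subr_le0 h1E.
  by rewrite leNgt ltz_nat c0.
have AB1 : A 1 = B 1 by move: h1E; rewrite c0 => /eqP; rewrite subr_eq0 => /eqP.
apply: finite_permP => // x; apply/idP/idP; apply: contraTT; rewrite -!ltNge => lt0.
  case ax : (code_a c x); first by have [] := coded_up cAB ax; lia.
  have [_ e] := coded_down cAB (negbT ax); rewrite ltNge; apply/negP => le0.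
  have s1 : s x < 1 by lia.
  have x1 : 1 <= x by lia.
  have [_] := counts_lt (coded_B cAB) s1; rewrite (coded_comp cAB) ax /=.
  have [_] := counts_le (coded_A cAB) x1; rewrite -e AB1; lra.
case ax : (code_a c x); last by have [] := coded_down cAB (negbT ax); lia.
have [_ e] := coded_up cAB ax; rewrite ltNge; apply/negP => le0.
have x1 : x < 1 by lia.
have s1 : 1 <= s x by lia.
have [+ _] := counts_lt (coded_A cAB) x1; rewrite ax /=.
by have [+ _] := counts_le (coded_B cAB) s1; rewrite e AB1; lra.
Qed.

Definition codes_of_area k : {set code} :=
  [set c | valid_code c && (code_area c == k)].

Lemma card_affine321 k : (k <= K)%N ->
  #|` fset_set (affine321_of_length n k)|%fset =
  #|[set c in codes_of_area k | ~~ flat_code c]|.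
Proof.
move=> le_kK; apply: (@card_fset_set_rel _ _ _ _ (fun c s => codes s c)).
- exact: finite_affine321.
- move=> c; rewrite !inE => /andP[/andP[vc /eqP area] nflat].
  have [s sc ds] := codes_exists vc nflat; exists s => //.
  have [sa _] := sc; have s321 := codes_avoids sc.
  by split=> //; apply/(coxeter_lengthP _ sa s321); rewrite ds area.
- move=> s [sa s321 /(coxeter_lengthP _ sa s321) ds].
  have [|c [vc nflat sc]] := @codes_total n' K s sa s321; first by rewrite ds; lia.
  exists c => //; rewrite !inE vc nflat andbT /=.
  by have := codes_disp vc nflat sc; rewrite ds; lia.
- by move=> c s s'; exact: codes_fun.
- move=> c c' s; rewrite !inE => /andP[/andP[vc /eqP ck] _].
  by move=> /andP[/andP[vc' /eqP ck'] _] _; apply: codes_inj; rewrite ?ck.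
Qed.

Lemma card_finite321 k : (k <= K)%N ->
  #|` fset_set (finite321_of_length n k)|%fset =
  #|[set c in codes_of_area k | c.1 ord0 == ord0]|.
Proof.
move=> le_kK; apply: (@card_fset_set_rel _ _ _ _ (fun c s => codes s c)).
- exact: finite_finite321.
- move=> c; rewrite !inE => /andP[/andP[vc /eqP area] /eqP c0].
  have nflat : ~~ flat_code c by rewrite /flat_code c0.
  have [s sc ds] := codes_exists vc nflat; exists s => //.
  have [sa _] := sc; have s321 := codes_avoids sc; split=> //.
    exact/(codes_finite vc nflat sc).
  by apply/(coxeter_lengthP _ sa s321); rewrite ds area.
- move=> s [sf s321]; have [sa _] := sf => /(coxeter_lengthP _ sa s321) ds.
  have [|c [vc nflat sc]] := @codes_total n' K s sa s321; first by rewrite ds; lia.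
  exists c => //; rewrite !inE vc /=; apply/andP; split.
    by have := codes_disp vc nflat sc; rewrite ds; lia.
  by apply/eqP/(codes_finite vc nflat sc).
- by move=> c s s'; exact: codes_fun.
- move=> c c' s; rewrite !inE => /andP[/andP[vc /eqP ck] _].
  by move=> /andP[/andP[vc' /eqP ck'] _] _; apply: codes_inj; rewrite ?ck.
Qed.

Lemma card_flat k : (k <= K)%N ->
  #|[set c in codes_of_area k | flat_code c]| = (((0 < k) && (n %| k))%N).*2.
Proof.
move=> le_kK.
pose F (e : bool) : code := ([ffun=> inord (k %/ n)], [ffun=> (e, e)]).
have F_inj : injective F.
  by move=> e e' /(congr1 (fun c : code => (c.2 ord0).1)); rewrite !ffunE.
have ltk : (k %/ n < K.+1)%N by rewrite ltnS (leq_trans (leq_div k n)).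
have flatF c : c \in codes_of_area k -> flat_code c ->
    [/\ (0 < k)%N, (n %| k)%N & exists e, c = F e].
  rewrite inE => /andP[vc /eqP area].
  move=> /andP[h0 /existsP[[e e'] /andP[/eqP /= <-] /forallP const]].
  have ca x : code_a c x = e by rewrite /code_a; have /eqP -> := const (res n' x).
  have [hE _] := code_const vc ca.
  have cE j : c.1 j = c.1 ord0.
    apply: val_inj; have := hE j.+1%:Z (ord0 : 'I_n).+1%:Z.
    by rewrite /code_h !resE => -[].
  have kE : k = (c.1 ord0 * n)%N.
    rewrite -area /code_area; under eq_bigr do rewrite cE.
    by rewrite sum_nat_const card_ord mulnC.
  split; [by rewrite kE muln_gt0 h0 | by rewrite kE dvdn_mull |].
  exists e; case: c cE kE const {vc area ca hE h0} => f g /= cE kE const.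
  congr pair; apply/ffunP => j; rewrite ffunE; last exact/eqP.
  by rewrite cE kE mulnK // inord_val.
case: (boolP ((0 < k) && (n %| k))%N) => [/andP[k0 nk]|kn]; last first.
  apply/eqP; rewrite cards_eq0; apply/eqP/setP => c; rewrite !inE.
  apply/negP => /andP[ck /flatF]; rewrite inE => /(_ ck)[k0 nk _].
  by case/negP: kn; rewrite k0.
transitivity #|F @: [set: bool]|; last by rewrite card_imset // cardsT card_bool.
apply: eq_card => c; apply/idP/imsetP => [|[e _ ->]].
  by rewrite inE => /andP[ck /(flatF _ ck)[_ _ [e ->]]]; exists e.
have kE : ((k %/ n)%N : nat) = (inord (k %/ n) : 'I_K.+1) by rewrite inordK.
rewrite !inE; apply/andP; split.
  apply/andP; split.
    apply/forallP => j; rewrite /step_ok !ffunE -kE eqxx divn_gt0 //.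
    by rewrite dvdn_leq // !orbT.
  rewrite /code_area; under eq_bigr do rewrite ffunE -kE.
  by rewrite sum_nat_const card_ord mulnC divnK.
rewrite /flat_code ffunE -kE divn_gt0 // dvdn_leq //=.
by apply/existsP; exists (e, e); rewrite eqxx; apply/forallP => j; rewrite ffunE.
Qed.

Lemma card_codes k : (k <= K)%N ->
  #|codes_of_area k| = (#|` fset_set (affine321_of_length n k)|%fset +
    (((0 < k) && (n %| k))%N).*2)%N.
Proof.
move=> le_kK; rewrite card_affine321 // -card_flat // addnC.
rewrite -(cardsID [set c | flat_code c] (codes_of_area k)).
by congr (_ + _)%N; apply: eq_card => c; rewrite !inE // andbC.
Qed.

End Cardinals.

(** * The transfer matrix *)

Section ClosedPaths.
Variables (R : comNzRingType) (K : nat).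
Implicit Type M : 'M[R]_K.+1.

Lemma mx_exp_walks M m i j : (M ^+ m) i j =
  \sum_(f : {ffun 'I_m.+1 -> 'I_K.+1} | (f ord0 == i) && (f ord_max == j))
    \prod_(l < m) M (f (widen_ord (leqnSn m) l)) (f (lift ord0 l)).
Proof.
elim: m i => [|m IHm] i.
  have ord1 (l : 'I_1) : l = ord0 by rewrite [l]ord1.
  pose c (k : 'I_K.+1) : {ffun 'I_1 -> 'I_K.+1} := [ffun=> k].
  rewrite expr0 mxE -[(i == j)]andbT; have [->|ij] := eqVneq i j.
    rewrite (big_pred1 (c j)) ?big_ord0 // => f /=.
    rewrite [ord_max]ord1 andbb; apply/eqP/eqP => [fj|->]; last by rewrite ffunE.
    by apply/ffunP => l; rewrite ffunE [l]ord1.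
  rewrite big1 // => f /andP[/eqP fi]; rewrite [ord_max]ord1 fi => /eqP e.
  by rewrite e eqxx in ij.
pose cons (u : 'I_K.+1 * {ffun 'I_m.+1 -> 'I_K.+1}) :
    {ffun 'I_m.+2 -> 'I_K.+1} :=
  [ffun l => if unlift ord0 l is Some l' then u.2 l' else u.1].
pose uncons (f : {ffun 'I_m.+2 -> 'I_K.+1}) :=
  (f ord0, [ffun l => f (lift ord0 l)]) : _ * {ffun 'I_m.+1 -> 'I_K.+1}.
have cons0 u : cons u ord0 = u.1 by rewrite ffunE unlift_none.
have consS u l : cons u (lift ord0 l) = u.2 l by rewrite ffunE liftK.
have consK : cancel cons uncons.
  move=> [k f]; rewrite /uncons cons0; congr pair; apply/ffunP => l.
  by rewrite ffunE consS.
have unconsK : cancel uncons cons.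
  move=> f; apply/ffunP => l; case: (unliftP ord0 l) => [l' ->|->].
    by rewrite consS ffunE.
  by rewrite cons0.
rewrite (reindex cons) /=; last first.
  by apply: onW_bij; exists uncons.
rewrite exprS mxE.
have maxS : ord_max = lift ord0 ord_max :> 'I_m.+2 by apply: val_inj.
transitivity (\sum_(f : {ffun 'I_m.+1 -> 'I_K.+1} | f ord_max == j)
   M i (f ord0) *
   \prod_(l < m) M (f (widen_ord (leqnSn m) l)) (f (lift ord0 l))).
  rewrite [RHS](partition_big
    (fun f : {ffun 'I_m.+1 -> 'I_K.+1} => f ord0) xpredT) //=.
  apply: eq_bigr => k _; rewrite IHm big_distrr /=.
  apply: eq_big => f; first by rewrite andbC.
  by move=> /andP[/eqP -> _].
transitivity (\sum_(u : 'I_K.+1 * {ffun 'I_m.+1 -> 'I_K.+1} |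
      (u.1 == i) && (u.2 ord_max == j))
    M u.1 (u.2 ord0) * \prod_(l < m)
      M (u.2 (widen_ord (leqnSn m) l)) (u.2 (lift ord0 l))).
  rewrite -(pair_big_dep (fun k => k == i)
    (fun _ (f : {ffun 'I_m.+1 -> 'I_K.+1}) => f ord_max == j)
    (fun k f => M k (f ord0) * \prod_(l < m)
      M (f (widen_ord (leqnSn m) l)) (f (lift ord0 l)))) /=.
  by rewrite big_pred1_eq.
apply: eq_big => [u|u _]; first by rewrite cons0 maxS consS.
rewrite big_ord_recl; congr (_ * _).
  by rewrite consS (_ : widen_ord _ _ = ord0) ?cons0 //; apply: val_inj.
apply: eq_bigr => l _; rewrite consS.
have -> : widen_ord (leqnSn m.+1) (lift ord0 l) =
  lift ord0 (widen_ord (leqnSn m) l) by apply: val_inj.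
by rewrite consS.
Qed.

(** The closed walk is folded onto a cycle: [ordS] sends the last index back to the first. *)
Lemma mx_exp_closed M n' i : (M ^+ n'.+1) i i =
  \sum_(f : {ffun 'I_n'.+1 -> 'I_K.+1} | f ord0 == i)
    \prod_(l < n'.+1) M (f l) (f (ordS l)).
Proof.
rewrite exprSr mxE [RHS](partition_big
  (fun f : {ffun 'I_n'.+1 -> 'I_K.+1} => f ord_max) xpredT) //=.
apply: eq_bigr => k _; rewrite mx_exp_walks big_distrl /=.
apply: eq_bigr => f /andP[/eqP f0 /eqP fm]; rewrite big_ord_recr /=.
have -> : ordS ord_max = ord0 :> 'I_n'.+1 by apply: val_inj; rewrite /= modnn.
rewrite f0 fm; congr (_ * _); apply: eq_bigr => l _.
congr (M (f _) (f _)); apply: val_inj => //=.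
by rewrite modn_small // ltnS.
Qed.

End ClosedPaths.

Section TransferMatrix.
Variable K : nat.

(** A step weighs [q] to the height where it starts, so a closed walk weighs [q] to its area. *)
Definition transfer_mx : 'M[fps int]_K.+1 :=
  \matrix_(h, h') \sum_(ab : bool * bool)
    (step_ok h ab h')%:R * base_q ^+ h.

Lemma coef_base_qX m k : (base_q ^+ m)`@k = (k == m)%:R.
Proof.
rewrite -[base_q ^+ m]mulr1 fps_coefMXn.
case: ltngtP => [//|gt|->]; last by rewrite subnn.
by move: (subn_gt0 m k); rewrite gt; case: (k - m)%N.
Qed.

Lemma transfer_closed n' h : (transfer_mx ^+ n'.+1) h h =
  \sum_(c : code n' K | valid_code c && (c.1 ord0 == h)) base_q ^+ code_area c.
Proof.
rewrite mx_exp_closed.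
transitivity (\sum_(f : {ffun 'I_n'.+1 -> 'I_K.+1} | f ord0 == h)
  \sum_(g : {ffun 'I_n'.+1 -> bool * bool})
    (valid_code ((f, g) : code n' K))%:R *
    base_q ^+ code_area ((f, g) : code n' K)).
  apply: eq_bigr => f _; under eq_bigr do rewrite mxE.
  rewrite bigA_distr_bigA /=; apply: eq_bigr => g _.
  rewrite big_split /= -natr_prod -(big_morph _ (exprD base_q) (expr0 base_q)).
  congr (_%:R * _); case: (boolP (valid_code _)) => [/forallP v|/forallPn[l]].
    by rewrite big1 // => l _; have /= -> := v l.
  by move=> /= /negPf vl; rewrite (bigD1 l) //= vl.
rewrite pair_big_dep /= [RHS]big_mkcondl /=.
by apply: eq_big => [[f g]|[f g] _]; rewrite ?andbT //; case: ifP => _;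
  rewrite ?mul1r ?mul0r.
Qed.

Lemma transfer_closed_coef n' h k : ((transfer_mx ^+ n'.+1) h h)`@k =
  #|[set c in codes_of_area n' K k | c.1 ord0 == h]|%:Z.
Proof.
rewrite transfer_closed fps_coef_sum; under eq_bigr do rewrite coef_base_qX.
rewrite -[RHS]natz -sum1_card natr_sum [RHS]big_mkcond [LHS]big_mkcond /=.
apply: eq_bigr => c _; rewrite !inE [k == _]eq_sym.
by case: (valid_code c); case: (code_area c == k); case: (_ == h).
Qed.

Lemma transfer_trace_coef n' k : (\tr (transfer_mx ^+ n'.+1))`@k =
  #|codes_of_area n' K k|%:Z.
Proof.
rewrite /mxtrace fps_coef_sum; under eq_bigr do rewrite transfer_closed_coef.
under eq_bigr do rewrite -natz.
rewrite -natr_sum -[RHS]natz; congr _%:R.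
rewrite -sum1_card (partition_big (fun c : code n' K => c.1 ord0) xpredT) //=.
by apply: eq_bigr => h _; rewrite -sum1_card; apply: eq_bigl => c; rewrite !inE.
Qed.

End TransferMatrix.

(** * Formal power series *)

Lemma fps_coefB (R : zmodType) (f g : fps R) n : (f - g)`@n = f`@n - g`@n.
Proof. by []. Qed.

Section SeriesTools.
Variable R : comNzRingType.
Implicit Types (f g : fps R) (F : nat -> fps R) (c : R).

(** The derivation x d/dx, which keeps degrees and is the form in which J' enters the theorem. *)
Definition fps_euler f : fps R := Fps (fun n => f`@n *+ n).

Lemma fps_eulerE f : fps_euler f = fps_X * fps_deriv f.
Proof. by apply: fpsP => -[|n]; rewrite fps_coefMX. Qed.

Lemma fps_eulerD f g : fps_euler (f + g) = fps_euler f + fps_euler g.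
Proof. by apply: fpsP => n /=; rewrite mulrnDl. Qed.

Lemma fps_eulerN f : fps_euler (- f) = - fps_euler f.
Proof. by apply: fpsP => n /=; rewrite mulNrn. Qed.

Lemma fps_eulerM f g : fps_euler (f * g) = fps_euler f * g + f * fps_euler g.
Proof.
apply: fpsP => n; rewrite /= -big_split -sumrMnl; apply: eq_bigr => i _ /=.
have le_in : (i <= n)%N by rewrite -ltnS.
by rewrite mulrnAl mulrnAr -mulrnDr subnKC.
Qed.

Lemma fps_euler_const c : fps_euler (fps_const c) = 0.
Proof. by apply: fpsP => -[|n] //=; rewrite mul0rn. Qed.

Lemma fps_euler_X : fps_euler fps_X = fps_X :> fps R.
Proof. by apply: fpsP => -[|[|n]] //=; rewrite mul0rn. Qed.

Fact fps_euler_is_additive : zmod_morphism fps_euler.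
Proof. by move=> f g; rewrite fps_eulerD fps_eulerN. Qed.
HB.instance Definition _ :=
  GRing.isZmodMorphism.Build (fps R) (fps R) fps_euler fps_euler_is_additive.

Lemma fps_coefCM c f n : (fps_const c * f)`@n = c * f`@n.
Proof.
rewrite fps_coefM big_ord_recl subn0 big1 ?addr0 // => i _.
by rewrite mul0r.
Qed.

Fact fps_const_is_additive : zmod_morphism (@fps_const R).
Proof. by move=> c d; apply: fpsP => -[|n] //=; rewrite subr0. Qed.
HB.instance Definition _ :=
  GRing.isZmodMorphism.Build R (fps R) (@fps_const R) fps_const_is_additive.

Fact fps_const_is_multiplicative : monoid_morphism (@fps_const R).
Proof.
by split=> // c d; apply: fpsP => -[|n]; rewrite fps_coefCM //= mulr0.
Qed.
HB.instance Definition _ :=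
  GRing.isMonoidMorphism.Build R (fps R) (@fps_const R)
    fps_const_is_multiplicative.

Fact fps_scale_is_additive c : zmod_morphism (fps_scale c).
Proof. by move=> f g; apply: fpsP => n /=; rewrite mulrBr. Qed.
HB.instance Definition _ c :=
  GRing.isZmodMorphism.Build (fps R) (fps R) (fps_scale c)
    (fps_scale_is_additive c).

Fact fps_scale_is_multiplicative c : monoid_morphism (fps_scale c).
Proof.
split=> [|f g]; first by apply: fpsP => -[|n]; rewrite /= ?mul1r ?mulr0.
apply: fpsP => n; rewrite /= mulr_sumr; apply: eq_bigr => i _.
have le_in : (i <= n)%N by rewrite -ltnS.
by rewrite mulrACA -exprD subnKC.
Qed.
HB.instance Definition _ c :=
  GRing.isMonoidMorphism.Build (fps R) (fps R) (fps_scale c)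
    (fps_scale_is_multiplicative c).

Lemma fps_scale_const c d : fps_scale c (fps_const d) = fps_const d.
Proof. by apply: fpsP => -[|n] /=; rewrite ?mul1r ?mulr0. Qed.

Lemma fps_scale_X c : fps_scale c fps_X = fps_const c * fps_X.
Proof.
by apply: fpsP => n; rewrite fps_coefCM /=; case: n => [|[|n]]; rewrite ?mulr0.
Qed.

Lemma fps_scaleM c d f : fps_scale c (fps_scale d f) = fps_scale (c * d) f.
Proof. by apply: fpsP => n /=; rewrite mulrA exprMn. Qed.

Lemma fps_scale1 f : fps_scale 1 f = f.
Proof. by apply: fpsP => n /=; rewrite expr1n mul1r. Qed.

Lemma fps_X_inj f g : fps_X * f = fps_X * g -> f = g.
Proof.
move=> fg; apply: fpsP => n.
by have := congr1 (@fps_coef R ^~ n.+1) fg; rewrite !fps_coefMX.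
Qed.

Definition summable F := forall n k, (k < n)%N -> (F n)`@k = 0.

Lemma summableM F (g : nat -> fps R) : summable F -> summable (fun n => F n * g n).
Proof.
move=> F0 n k lt_kn; rewrite fps_coefM big1 // => i _.
by rewrite F0 ?mul0r // (leq_ltn_trans _ lt_kn) // -ltnS.
Qed.

Lemma summable_scale c F : summable F -> summable (fun n => fps_scale c (F n)).
Proof. by move=> F0 n k ltkn /=; rewrite F0 // mulr0. Qed.

Lemma fps_sumM F g : summable F -> fps_sum F * g = fps_sum (fun n => F n * g).
Proof.
move=> F0; apply: fpsP => m.
rewrite -(fps_sum_stable (summableM (fun=> g) F0) (ltnSn m)) -mulr_suml !fps_coefM.
apply: eq_bigr => i _; congr (_ * _); symmetry.
by apply: fps_sum_stable.
Qed.

Lemma fps_sumD F G : fps_sum F + fps_sum G = fps_sum (fun n => F n + G n).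
Proof. by apply: fpsP => m /=; rewrite -big_split. Qed.

Lemma eq_fps_sum F G : F =1 G -> fps_sum F = fps_sum G.
Proof. by move=> FG; apply: fpsP => m; apply: eq_bigr => i _; rewrite FG. Qed.

Lemma fps_sumX F : fps_X * fps_sum F =
  fps_sum (fun n => if n is n'.+1 then fps_X * F n' else 0).
Proof.
apply: fpsP => -[|m]; rewrite fps_coefMX [RHS]big_ord_recl add0r.
  by rewrite big_ord0.
by apply: eq_bigr => i _; rewrite lift0 fps_coefMX.
Qed.

Lemma fps_scale_sum c F :
  fps_scale c (fps_sum F) = fps_sum (fun n => fps_scale c (F n)).
Proof. by apply: fpsP => m /=; rewrite mulr_sumr. Qed.

End SeriesTools.

(** * Determinants and bidiagonal matrices *)

Section Jacobi.
Variable R : comNzRingType.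
Implicit Types f g : fps R.

Lemma fps_euler_prod (I : finType) (F : I -> fps R) :
  fps_euler (\prod_i F i) =
  \sum_i \prod_j (if j == i then fps_euler (F j) else F j).
Proof.
pose G (i j : I) := if j == i then fps_euler (F j) else F j.
have step (s : seq I) : uniq s -> fps_euler (\prod_(j <- s) F j) =
    \sum_(i <- s) \prod_(j <- s) G i j.
  elim: s => [_|i s IHs /= /andP[nis us]].
    by rewrite !big_nil (fps_euler_const 1).
  rewrite big_cons fps_eulerM IHs // big_cons big_cons [G i i]/G eqxx.
  congr (_ * _ + _).
    apply: eq_big_seq => j js; rewrite /G; case: eqP => // ji.
    by rewrite ji (negPf nis) in js *.
  rewrite mulr_sumr; apply: eq_big_seq => j js; rewrite big_cons {2}/G.
  by case: eqP => // ij; rewrite ij js in nis.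
exact: step (index_enum_uniq I).
Qed.

(** Jacobi's formula: the derivation acts on one row at a time, and expanding along that row
    produces the adjugate. *)
Lemma fps_euler_det n (M : 'M[fps R]_n) :
  fps_euler (\det M) = \tr (map_mx (@fps_euler R) M *m \adj M).
Proof.
pose N i : 'M[fps R]_n :=
  \matrix_(k, l) if k == i then fps_euler (M k l) else M k l.
transitivity (\sum_i \det (N i)).
  rewrite /determinant raddf_sum exchange_big; apply: eq_bigr => s _ /=.
  rewrite -mulr_sumr !mulr_sign.
  have <- : fps_euler (\prod_i M i (s i)) = \sum_i \prod_j N i j (s j).
    rewrite fps_euler_prod; apply: eq_bigr => i _; apply: eq_bigr => j _.
    by rewrite mxE.
  by case: (odd_perm s); rewrite ?fps_eulerN.
apply: eq_bigr => i _; rewrite mxE (expand_det_row _ i).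
apply: eq_bigr => j _; rewrite !mxE eqxx; congr (_ * (_ * \det _)).
by apply/matrixP => k l; rewrite !mxE eq_sym (negPf (neq_lift _ _)).
Qed.

End Jacobi.

Section LogDerivative.
Variable R : comUnitRingType.
Implicit Types f g : fps R.

Definition fps_dlog f := fps_euler f / f.

Lemma fps_dlogM f g : f \is a GRing.unit -> g \is a GRing.unit ->
  fps_dlog (f * g) = fps_dlog f + fps_dlog g.
Proof.
move=> uf ug; rewrite /fps_dlog fps_eulerM invrM // mulrDl; congr (_ + _).
  by rewrite mulrA mulrK.
by rewrite [f * _]mulrC mulrA -mulrA mulrAC mulrA mulrVK // mulrC.
Qed.

Lemma fps_dlog1 : fps_dlog 1 = 0.
Proof. by rewrite /fps_dlog (fps_euler_const 1) mul0r. Qed.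

Lemma fps_dlog_prod n (F : nat -> fps R) : (forall i, F i \is a GRing.unit) ->
  fps_dlog (\prod_(i < n) F i) = \sum_(i < n) fps_dlog (F i).
Proof.
move=> uF; elim: n => [|n IHn]; first by rewrite !big_ord0 fps_dlog1.
by rewrite !big_ord_recr /= fps_dlogM ?IHn // unitr_prod_in.
Qed.

Lemma fps_dlog_det n (M : 'M[fps R]_n) : M \in unitmx ->
  fps_dlog (\det M) = \tr (map_mx (@fps_euler R) M *m invmx M).
Proof.
move=> uM; rewrite /fps_dlog fps_euler_det /invmx uM -scalemxAr mxtraceZ.
by rewrite mulrC.
Qed.

End LogDerivative.

Section Bidiagonal.
Variables (R : comNzRingType) (K : nat) (u l p : nat -> R).

Definition upper_mx : 'M[R]_K.+1 :=
  \matrix_(i, j) ((i == j)%:R + (j == i.+1 :> nat)%:R * u i).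

Definition lower_mx : 'M[R]_K.+1 :=
  \matrix_(i, j) ((i == j)%:R * p i + (i == j.+1 :> nat)%:R * l j).

Lemma det_upper_mx : \det upper_mx = 1.
Proof.
rewrite -det_tr det_trig; last first.
  apply/is_trig_mxP => i j ltij; rewrite !mxE.
  by rewrite -val_eqE gtn_eqF // ltn_eqF ?mul0r ?addr0 // ltnW.
rewrite big1 // => i _; rewrite !mxE eqxx.
by rewrite -[_ == _.+1]/(_ == _)%N ltn_eqF // mul0r addr0.
Qed.

Lemma det_lower_mx : \det lower_mx = \prod_(i < K.+1) p i.
Proof.
rewrite det_trig; last first.
  apply/is_trig_mxP => i j ltij; rewrite !mxE.
  by rewrite -val_eqE ltn_eqF // ltn_eqF ?mul0r ?addr0 // ltnW.
apply: eq_bigr => i _; rewrite !mxE eqxx mul1r.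
by rewrite ltn_eqF // mul0r addr0.
Qed.

(** The last row lacks [u i * l i], which would pass through index [K + 1]; this is the only effect
    of the finite size. *)
Lemma upper_lower_mxE i j : (upper_mx *m lower_mx) i j =
  (i == j)%:R * (p i + (i < K)%N%:R * (u i * l i)) +
  (j == i.+1 :> nat)%:R * (u i * p j) + (i == j.+1 :> nat)%:R * l j.
Proof.
rewrite mxE (bigD1 i) //= !mxE eqxx.
have -> : (i == i.+1 :> nat) = false by rewrite ltn_eqF.
rewrite mul0r addr0 mul1r.
have [iK|iK] := ltnP i K; last first.
  have iE : i = K :> nat by apply/eqP; rewrite eqn_leq iK -ltnS ltn_ord.
  have -> : (j == i.+1 :> nat) = false by rewrite ltn_eqF // iE.
  rewrite big1 ?addr0 ?mul0r ?addr0 // => k ki; rewrite !mxE.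
  rewrite [i == k]eq_sym (negPf ki) (_ : (k == i.+1 :> nat) = false).
    by rewrite mul0r addr0 mul0r.
  by rewrite ltn_eqF // iE.
pose i' : 'I_K.+1 := Ordinal (iK : (i.+1 < K.+1)%N).
rewrite (bigD1 i') /=; last by rewrite -val_eqE /= gtn_eqF.
rewrite big1 ?addr0 => [|k /andP[ki ki']]; last first.
  rewrite !mxE [i == k]eq_sym (negPf ki) -[_ == i.+1]/(k == i') (negPf ki').
  by rewrite mul0r addr0 mul0r.
rewrite !mxE /= eqxx -[i == i']val_eqE /= (@ltn_eqF i i.+1) // add0r mul1r.
rewrite -[i' == j]val_eqE /= eqSS [i.+1 == j]eq_sym -[(i : nat) == j]/(i == j).
have [<-|_] := eqVneq i j; first by rewrite [i == i.+1 :> nat]ltn_eqF //=; ring.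
by case: (j =P i.+1 :> nat) => [->|_] /=; ring.
Qed.

(** Together with [lower_mulmx0], this shows that the upper left entry of the inverse of upper times
    lower is the inverse of [p 0]. *)
Lemma mulmx_upper0 (M : 'M[R]_K.+1) i : (M *m upper_mx) i ord0 = M i ord0.
Proof.
rewrite mxE (bigD1 ord0) //= big1 => [|k k0].
  by rewrite mxE /= mul0r !addr0 mulr1.
by rewrite [upper_mx _ _]mxE (negPf k0) /= mul0r addr0 mulr0.
Qed.

Lemma lower_mulmx0 (M : 'M[R]_K.+1) j :
  (lower_mx *m M) ord0 j = p 0%N * M ord0 j.
Proof.
rewrite mxE (bigD1 ord0) //= big1 => [|k k0].
  by rewrite [lower_mx _ _]mxE /= mul0r !addr0 mul1r.
by rewrite [lower_mx _ _]mxE eq_sym (negPf k0) /= !mul0r addr0 mul0r.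
Qed.

End Bidiagonal.

(** * q-difference equations *)

Lemma qpochS (R : comPzRingType) (a b : R) n :
  qpoch a b n.+1 = qpoch a b n * (1 - a * b ^+ n).
Proof. exact: big_ord_recr. Qed.

Lemma qpochSl (R : comPzRingType) (a b : R) n :
  qpoch a b n.+1 = (1 - a) * qpoch (a * b) b n.
Proof.
rewrite /qpoch big_ord_recl expr0 mulr1; congr (_ * _).
by apply: eq_bigr => i _; rewrite -mulrA -exprS.
Qed.

Section Terms.
Variables (R : comUnitRingType) (x q : R).
Hypothesis q_unit : forall n, qpoch q q n \is a GRing.unit.
Hypothesis xq_unit : forall n, qpoch (x * q) q n \is a GRing.unit.

Definition term n : R :=
  (- x) ^+ n * q ^+ 'C(n, 2) / (qpoch q q n * qpoch (x * q) q n).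

(** The term of J(xq) / (1 - xq): the factor 1 - xq completes (xq^2; q)_n to (xq; q)_(n+1). *)
Definition shift_term n : R :=
  (- x) ^+ n * q ^+ n * q ^+ 'C(n, 2) /
  (qpoch q q n * qpoch (x * q) q n.+1).

Lemma termK n : term n * (qpoch q q n * qpoch (x * q) q n) =
  (- x) ^+ n * q ^+ 'C(n, 2).
Proof. by rewrite divrK // unitrM q_unit xq_unit. Qed.

Lemma shift_termK n : shift_term n * (qpoch q q n * qpoch (x * q) q n.+1) =
  (- x) ^+ n * q ^+ n * q ^+ 'C(n, 2).
Proof. by rewrite divrK // unitrM q_unit xq_unit. Qed.

Lemma term_shift n : term n * q ^+ n = shift_term n * (1 - x * q ^+ n.+1).
Proof.
have u : qpoch q q n * qpoch (x * q) q n \is a GRing.unit.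
  by rewrite unitrM q_unit xq_unit.
apply: (mulIr u); rewrite mulrAC termK.
transitivity (shift_term n * (qpoch q q n * qpoch (x * q) q n.+1)).
  by rewrite shift_termK mulrAC.
by rewrite qpochS -(mulrA x) -exprS; ring.
Qed.

(** The left side cancels the last factor of (q; q)_(n+1), and the difference [n] of the two
    binomials supplies the [q ^+ n] of [shift_term]. *)
Lemma termS n : term n.+1 * q ^+ n.+1 - term n.+1 = x * shift_term n.
Proof.
have u : qpoch q q n.+1 * qpoch (x * q) q n.+1 \is a GRing.unit.
  by rewrite unitrM q_unit xq_unit.
apply: (mulIr u); rewrite mulrBl mulrAC termK.
rewrite binS bin1 exprD exprS.
have e := shift_termK n; rewrite [qpoch q q n.+1]qpochS.
transitivity (x * (shift_term n * (qpoch q q n * qpoch (x * q) q n.+1)) *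
  (1 - q * q ^+ n)); last by ring.
by rewrite e [q ^+ n.+1]exprS; move: (_ ^+ n) => X; ring.
Qed.

Lemma term_scale (phi : {rmorphism R -> R}) n :
  phi x = x * q -> phi q = q -> phi (term n) / (1 - x * q) = shift_term n.
Proof.
move=> phix phiq.
have phi_qpoch a : phi (qpoch a q n) = qpoch (phi a) q n.
  rewrite /qpoch rmorph_prod; apply: eq_bigr => i _.
  by rewrite rmorphB rmorphM rmorphXn rmorph1 phiq.
have u : qpoch q q n * qpoch (x * q) q n.+1 \is a GRing.unit.
  by rewrite unitrM q_unit xq_unit.
have u1 : 1 - x * q \is a GRing.unit.
  by have := xq_unit 1; rewrite /qpoch big_ord1 expr0 mulr1.
apply: (mulIr u); rewrite shift_termK qpochSl.
move: (term n) (termK n) => t /(congr1 phi).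
rewrite !rmorphM !rmorphXn rmorphN !phi_qpoch rmorphM phix phiq.
rewrite -[X in X ^+ n]mulNr exprMn => <-.
by have := divrK u1 (phi t); set d := _ / _ => <-; ring.
Qed.

End Terms.

(* The two relations between [J], [H] and [J(xq) / (1 - xq)] combine into a
   second order q-difference equation for [H]. *)
Lemma q_difference (R : comUnitRingType) (phi : {rmorphism R -> R})
    (x q Jx Hx B : R) :
    1 - x * q \is a GRing.unit -> phi x = x * q -> phi q = q ->
    B = phi Jx / (1 - x * q) -> Hx = Jx + x * B ->
    B = Hx + x * q * (phi Hx / (1 - x * q)) ->
  (1 - x * q) * Hx = (1 - (x * q) *+ 2) * phi Hx -
    x ^+ 2 * q ^+ 3 * (phi (phi Hx) / (1 - x * q ^+ 2)).
Proof.
move=> u phix phiq BE HJ BH.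
have phiJ : phi Jx = (1 - x * q) * Hx + x * q * phi Hx.
  have <- : (1 - x * q) * B = phi Jx by rewrite BE mulrC divrK.
  have e := divrK u (phi Hx); rewrite [in LHS]BH -{2}e; ring.
have sc1 : phi (1 - x * q) = 1 - x * q ^+ 2.
  by rewrite rmorphB rmorphM rmorph1 phix phiq -mulrA -expr2.
have e1 : phi Hx = phi Jx + x * q * phi B by rewrite {1}HJ rmorphD rmorphM phix.
have e2 : phi B = phi Hx + x * q * q * (phi (phi Hx) / (1 - x * q ^+ 2)).
  by rewrite {1}BH rmorphD !rmorphM rmorphV // sc1 phix phiq.
move: e1; rewrite e2 phiJ; set a := _ / _; move=> e1.
have -> : (1 - x * q) * Hx = phi Hx - x * q * phi Hx -
  x * q * (phi Hx + x * q * q * a) by rewrite {1}e1; ring.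
by ring.
Qed.

Lemma q_difference_iter (R : comUnitRingType) (phi : {rmorphism R -> R})
    (x q : R) (H : nat -> R) :
    phi x = x * q -> phi q = q -> (forall n, phi (H n) = H n.+1) ->
    (forall n, 1 - x * q ^+ n.+1 \is a GRing.unit) ->
    (1 - x * q) * H 0%N = (1 - (x * q) *+ 2) * H 1%N -
      x ^+ 2 * q ^+ 3 * (H 2%N / (1 - x * q ^+ 2)) ->
  forall n, (1 - x * q ^+ n.+1) * H n =
    (1 - (x * q ^+ n.+1) *+ 2) * H n.+1 -
    x ^+ 2 * q ^+ (n.*2 + 3) * (H n.+2 / (1 - x * q ^+ n.+2)).
Proof.
move=> phix phiq phiH u rec0; elim=> [|n IHn]; first by rewrite expr1.
have phi_xq m : phi (x * q ^+ m) = x * q ^+ m.+1.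
  by rewrite rmorphM rmorphXn phix phiq -mulrA -exprS.
have phi1 m c : phi (1 - (x * q ^+ m) *+ c) = 1 - (x * q ^+ m.+1) *+ c.
  by rewrite rmorphB rmorphMn rmorph1 phi_xq.
have := congr1 phi IHn; rewrite rmorphM (phi1 _ 1%N) phiH => ->.
rewrite rmorphB !rmorphM phi1 !phiH rmorphV // (phi1 _ 1%N) !rmorphXn phix phiq.
by rewrite doubleS !addSn !exprS; ring.
Qed.

Section Pivots.
Variables (R : comUnitRingType) (x q : R) (J B : R) (H : nat -> R).
Hypothesis J_H : H 0%N = J + x * B.
Hypothesis B_H : B = H 0%N + x * q * (H 1%N / (1 - x * q)).
Hypothesis H_rec : forall n, (1 - x * q ^+ n.+1) * H n =
  (1 - (x * q ^+ n.+1) *+ 2) * H n.+1 -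
  x ^+ 2 * q ^+ (n.*2 + 3) * (H n.+2 / (1 - x * q ^+ n.+2)).
Hypothesis J_unit : J \is a GRing.unit.
Hypothesis H_unit : forall n, H n \is a GRing.unit.
Hypothesis x_unit : forall n, 1 - x * q ^+ n.+1 \is a GRing.unit.

(** Ratios of consecutive solutions of the recurrence for [H] solve the continued fraction
    [pivot_rec]. Height 0 has a single level step, so its row breaks the recurrence and [J] takes
    over. *)
Definition pivot n : R :=
  if n is n'.+1 then (1 - x * q ^+ n'.+1) * H n' / H n'.+1 else J / H 0%N.

Lemma pivot_unit n : pivot n \is a GRing.unit.
Proof. by case: n => [|n]; rewrite /= !(unitrM, unitrV) ?J_unit ?x_unit !H_unit. Qed.

Lemma pivotSV n : (pivot n.+1)^-1 = H n.+1 / (1 - x * q ^+ n.+1) / H n.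
Proof.
apply: (mulrI (pivot_unit n.+1)); rewrite mulrV ?pivot_unit //=.
have := divrK (x_unit n) (H n.+1).
have := mulrV (H_unit n); have := mulVr (H_unit n.+1).
set a := (H n)^-1; set b := (H n.+1)^-1; set c := _ / _ => e1 e2 e3.
transitivity (b * (c * (1 - x * q ^+ n.+1)) * (H n * a)); last by ring.
by rewrite e3 e2 e1 mulr1.
Qed.

(** The right side is the diagonal of 1 - x A, and x^2 q^(2n+1) is the weight of going from height
    [n] to [n + 1] and back. *)
Lemma pivot_rec n : pivot n + x ^+ 2 * q ^+ n.*2.+1 / pivot n.+1 =
  1 - x * q ^+ n *+ (0 < n)%N.+1.
Proof.
rewrite pivotSV; apply: (mulIr (H_unit n)).
rewrite mulrDl !mulrA divrK //; case: n => [|n] /=.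
  rewrite divrK // expr0 mulr1 expr1 -[x ^+ 2 * q * H 1%N / _]mulrA.
  have BE := B_H; move: BE; set c := H 1%N / _ => BE.
  have -> : J = H 0%N - x * B by rewrite J_H; ring.
  by rewrite BE; ring.
rewrite divrK // H_rec mulr2n; set c := _ / _.
have -> : x ^+ 2 * q ^+ n.+1.*2.+1 * H n.+2 / (1 - x * q ^+ n.+2) =
   x ^+ 2 * q ^+ (n.*2 + 3) * c.
  by rewrite -[LHS]mulrA doubleS addn3.
by ring.
Qed.

(** The product telescopes; it brings [J] into the determinant, with explicit linear factors and one
    shift of [H]. *)
Lemma pivot_prod n : (\prod_(i < n.+1) pivot i) * H n =
  J * \prod_(i < n) (1 - x * q ^+ i.+1).
Proof.
elim: n => [|n IHn]; first by rewrite big_ord1 big_ord0 mulr1 /= divrK.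
rewrite big_ord_recr /= -mulrA divrK // mulrCA IHn [in RHS]big_ord_recr /=.
by ring.
Qed.

End Pivots.

(** * The series [J] and [H] and their q-difference equations *)

Section WalkSeries.

Local Notation x := var_x.
Local Notation q := var_q.
Local Notation series := (fps (fps int)).
Local Notation scale := (fps_scale base_q).

Lemma unit_1BxM (f : series) : 1 - x * f \is a GRing.unit.
Proof. by rewrite 2!fps_unitE 2!fps_coef0_1BM mul0r subr0 unitr1. Qed.

Lemma qpoch_xq_unit n : qpoch (x * q) q n \is a GRing.unit.
Proof. by apply: qpoch_unit; rewrite fps_coef0M mul0r. Qed.

Lemma qpoch_q_unit n : qpoch q q n \is a GRing.unit.
Proof. exact: qpoch_unit. Qed.

Lemma scale_q : scale q = q. Proof. exact: fps_scale_const. Qed.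

Lemma scale_x : scale x = x * q.
Proof. by rewrite [LHS]fps_scale_X mulrC. Qed.

Lemma scale_J_term_summable : summable (fun n => scale (J_term n)).
Proof. exact/summable_scale/J_term_ord. Qed.

Definition J_shift : series := scale J / (1 - x * q).

(** The numerator of the series of closed walks at height 0, whose denominator is [J]. *)
Definition H_series : series := fps_sum (fun n => J_term n * q ^+ n).

Lemma J_shiftE : J_shift = fps_sum (shift_term x q).
Proof.
rewrite /J_shift /J fps_scale_sum (fps_sumM _ scale_J_term_summable).
apply: eq_fps_sum => n.
exact: (term_scale qpoch_q_unit qpoch_xq_unit n scale_x scale_q).
Qed.

Lemma H_series_J : H_series = J + x * J_shift.
Proof.
rewrite J_shiftE fps_sumX fps_sumD; apply: eq_fps_sum => -[|n].
  by rewrite mulr1 addr0.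
by rewrite -(termS qpoch_q_unit qpoch_xq_unit n) addrC subrK.
Qed.

(** Termwise this is [term_shift], since [q ^ n * shift_term n] is the term of H(xq) / (1 - xq). *)
Lemma J_shift_H : J_shift = H_series + x * q * (scale H_series / (1 - x * q)).
Proof.
have sum1 : summable (fun n => scale (J_term n * q ^+ n)).
  by apply: summable_scale; apply: summableM; exact: J_term_ord.
rewrite /H_series fps_scale_sum [fps_sum _ / _]fps_sumM //.
rewrite [_ * fps_sum _]mulrC fps_sumM; last exact: summableM.
rewrite J_shiftE fps_sumD; apply: eq_fps_sum => n.
have e1 := term_shift qpoch_q_unit qpoch_xq_unit n.
have e2 := term_scale qpoch_q_unit qpoch_xq_unit n scale_x scale_q.
rewrite rmorphM rmorphXn /= scale_q (mulrAC (scale (J_term n)) (q ^+ n)).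
rewrite -[J_term n]/(term x q n) e1.
have -> : scale (term x q n) / (1 - x * q) = shift_term x q n := e2.
rewrite exprS; move: (shift_term x q n) => t; move: x q => y r.
by ring.
Qed.

Definition H_shift n : series := fps_scale (base_q ^+ n) H_series.

Lemma H_shiftS n : scale (H_shift n) = H_shift n.+1.
Proof. by rewrite /H_shift fps_scaleM -exprS. Qed.

Lemma H_shift0 : H_shift 0 = H_series.
Proof. by rewrite /H_shift fps_scale1. Qed.

Lemma H_rec0 : (1 - x * q) * H_shift 0 = (1 - (x * q) *+ 2) * H_shift 1 -
    x ^+ 2 * q ^+ 3 * (H_shift 2 / (1 - x * q ^+ 2)).
Proof.
rewrite -(H_shiftS 1) -(H_shiftS 0) H_shift0.
exact: (q_difference prefactor_unit scale_x scale_q erefl H_series_J J_shift_H).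
Qed.

Section QAdic.
Variable N : nat.
Implicit Types f g : series.

(* The ideal generated by [q ^+ N]. *)
Definition qdiv f := forall m k, (k < N)%N -> (f`@m)`@k = 0.

Lemma qdivD f g : qdiv f -> qdiv g -> qdiv (f + g).
Proof. by move=> qf qg m k ltkN /=; rewrite qf // qg // addr0. Qed.

Lemma qdivN f : qdiv f -> qdiv (- f).
Proof. by move=> qf m k ltkN /=; rewrite qf // oppr0. Qed.

Lemma qdivM f g : qdiv f -> qdiv (f * g).
Proof.
move=> qf m k ltkN; rewrite fps_coefM fps_coef_sum big1 // => i _.
rewrite fps_coefM big1 // => j _; rewrite qf ?mul0r //.
by rewrite (leq_ltn_trans _ ltkN) // -ltnS.
Qed.

Lemma qdivMr f g : qdiv f -> qdiv (g * f).
Proof. by rewrite mulrC; exact: qdivM. Qed.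

Lemma qdiv_sum I (r : seq I) (F : I -> series) :
  (forall i, qdiv (F i)) -> qdiv (\sum_(i <- r) F i).
Proof. by move=> qF; elim/big_ind: _ => // f g; exact: qdivD. Qed.

Lemma var_qX m : q ^+ m = fps_const (base_q ^+ m).
Proof. by rewrite rmorphXn. Qed.

Lemma qdiv_q m f : (N <= m)%N -> qdiv (q ^+ m * f).
Proof.
move=> leNm a k ltkN; rewrite var_qX fps_coefCM fps_coefMXn.
by rewrite (leq_trans ltkN).
Qed.

Lemma qdiv_euler f : qdiv f -> qdiv (fps_euler f).
Proof.
move=> qf m k ltkN /=; rewrite -mulr_natr.
suff -> : f`@m * m%:R = f`@m *+ m.
  by elim: {2}m => // l IHl; rewrite mulrS /= IHl qf.
by rewrite mulr_natr.
Qed.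

Lemma qdiv_mulmx (n : nat) (A B : 'M[series]_n) :
  (forall i j, qdiv (A i j)) -> forall i j, qdiv ((A *m B) i j).
Proof. by move=> qA i j; rewrite mxE; apply: qdiv_sum => k; exact: qdivM. Qed.

Lemma qdiv_mulmxr (n : nat) (A B : 'M[series]_n) :
  (forall i j, qdiv (A i j)) -> forall i j, qdiv ((B *m A) i j).
Proof. by move=> qA i j; rewrite mxE; apply: qdiv_sum => k; exact: qdivMr. Qed.

End QAdic.

Lemma H_shift_unit n : H_shift n \is a GRing.unit.
Proof.
have -> : (H_shift n \is a GRing.unit) = (J \is a GRing.unit); last exact: J_unit.
rewrite [LHS]fps_unitE [RHS]fps_unitE -[(H_shift n)`@0]/(_ ^+ 0 * H_series`@0) expr0 mul1r.
by rewrite H_series_J -[(J + _)`@0]/(J`@0 + _) fps_coefMX addr0.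
Qed.

Lemma H_rec n : (1 - x * q ^+ n.+1) * H_shift n =
  (1 - (x * q ^+ n.+1) *+ 2) * H_shift n.+1 -
  x ^+ 2 * q ^+ (n.*2 + 3) * (H_shift n.+2 / (1 - x * q ^+ n.+2)).
Proof.
exact: (q_difference_iter scale_x scale_q H_shiftS (fun=> unit_1BxM _) H_rec0).
Qed.

Definition J_pivot : nat -> series := pivot x q J H_shift.

Lemma J_pivot_unit n : J_pivot n \is a GRing.unit.
Proof. exact: (pivot_unit J_unit H_shift_unit (fun=> unit_1BxM _)). Qed.

Lemma J_pivot_rec n : J_pivot n + x ^+ 2 * q ^+ n.*2.+1 / J_pivot n.+1 =
  1 - x * q ^+ n *+ (0 < n)%N.+1.
Proof.
apply: (@pivot_rec _ x q J J_shift H_shift); rewrite ?H_shift0.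
- exact: H_series_J.
- by rewrite -(H_shiftS 0) H_shift0; exact: J_shift_H.
- exact: H_rec.
- exact: J_unit.
- exact: H_shift_unit.
- by move=> m; exact: unit_1BxM.
Qed.

(** * Walks of height at most [K], modulo [q ^ K] *)

Section Truncation.
Variable K : nat.
Local Notation A := (transfer_mx K).

Definition walk_mx : 'M[series]_K.+1 :=
  \matrix_(i, j) ((i == j)%:R - x * fps_const (A i j)).

Definition resolvent_mx : 'M[series]_K.+1 :=
  \matrix_(i, j) Fps (fun n => (A ^+ n) i j).

Definition factored_mx : 'M[series]_K.+1 :=
  upper_mx K (fun i => - (x * q ^+ i) / J_pivot i.+1) *m
  lower_mx K (fun i => - (x * q ^+ i.+1)) J_pivot.

Lemma transfer_mxE i j : A i j =
  ((i == j) * (0 < i)%N.+1 + (j == i.+1 :> nat) + (i == j.+1 :> nat))%N%:R *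
  base_q ^+ i.
Proof.
rewrite mxE -mulr_suml -natr_sum; congr (_%:R * _).
rewrite -(pair_big xpredT xpredT (fun a b => step_ok i (a, b) j : nat)) /=.
rewrite !big_bool /step_ok /= !addn1 !addn0 eqSS -[(i == j :> nat)]/(i == j).
rewrite [i.+1 == j]eq_sym !andbT.
by case: (i == j); case: (_ == i.+1); case: (_ == j.+1); case: (0 < i)%N.
Qed.

Lemma walk_mxE i j : walk_mx i j = (i == j)%:R -
  x * ((i == j) * (0 < i)%N.+1 + (j == i.+1 :> nat) + (i == j.+1 :> nat))%N%:R *
  q ^+ i.
Proof.
by rewrite mxE transfer_mxE rmorphM rmorphXn rmorph_nat mulrA.
Qed.

(** By [pivot_rec] only the corner (K, K) differs: there the term of [factored_mx] passing through
    height [K + 1] is missing. Its weight q^(2K+1) is split to display [q ^ K]. *)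
Lemma walk_factored i j : walk_mx i j - factored_mx i j =
  q ^+ K * ((i == j)%:R * (i == K :> nat)%:R *
    (x ^+ 2 * q ^+ K.+1 / J_pivot K.+1)).
Proof.
rewrite walk_mxE upper_lower_mxE.
have := J_pivot_rec i; have uP := J_pivot_unit i.+1.
have := divrK uP (- (x * q ^+ i)).
have iK : (i <= K)%N by rewrite -ltnS.
move: J_pivot uP => p uP; move: x q => y r; set u := _ / p i.+1 => up rec.
have ul : u * - (y * r ^+ i.+1) = y ^+ 2 * r ^+ i.*2.+1 / p i.+1.
  rewrite /u mulNr mulrNN -addnn -addSn exprD.
  by move: (p _)^-1 => b; ring.
have [<-|ij] := eqVneq i j.
  rewrite ltn_eqF // ul /= !mul1r !mul0r !addr0.
  have [ltiK|leKi] := ltnP i K.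
    rewrite mul1r rec (ltn_eqF ltiK) !mul0r mulr0 mul1n !addn0.
    by rewrite -[y * _ *+ _]mulr_natr; ring.
  have iE : i = K :> nat by apply/eqP; rewrite eqn_leq iK.
  rewrite mul0r addr0 mul1n !addn0 iE eqxx mul1r.
  move: rec; rewrite iE -[y * _ *+ _]mulr_natr => rec.
  have -> : r ^+ K * (y ^+ 2 * r ^+ K.+1 / p K.+1) =
      y ^+ 2 * r ^+ K.*2.+1 / p K.+1.
    by rewrite -addnn -addnS exprD; move: (p _)^-1 => b; ring.
  by rewrite mulrAC -rec addrC addKr.
rewrite !mul0r mulr0 add0r !mul0n !add0n.
have [->|ji] := eqVneq (j : nat) i.+1.
  by rewrite up mul1r (@ltn_eqF i i.+2) //= mul0r addr0 addn0; ring.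
by rewrite mul0r add0r add0n; have [->|_] := eqVneq (i : nat) j.+1 => /=; ring.
Qed.

Lemma walk_resolvent : walk_mx *m resolvent_mx = 1%:M.
Proof.
apply/matrixP => i j; rewrite !mxE.
transitivity (resolvent_mx i j -
  x * \sum_k fps_const (A i k) * resolvent_mx k j).
  rewrite mulr_sumr -sumrN (bigD1 i) //= [in RHS](bigD1 i) //= addrA.
  rewrite ![walk_mx _ _]mxE eqxx mulrBl mul1r mulrA; congr (_ + _).
  apply: eq_bigr => k ki; rewrite !mxE eq_sym (negPf ki) sub0r mulNr mulrA.
  by [].
have resE n k l : (resolvent_mx k l)`@n = (A ^+ n) k l by rewrite mxE.
apply: fpsP => n; rewrite fps_coefB fps_coefMX resE; case: n => [|n].
  by rewrite expr0 mxE subr0; case: (i == j).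
rewrite exprS mxE fps_coef_sum.
under [X in _ - X]eq_bigr do rewrite fps_coefCM resE.
by rewrite subrr; case: (i == j).
Qed.

Lemma det_factored : \det factored_mx = \prod_(i < K.+1) J_pivot i.
Proof. by rewrite det_mulmx det_upper_mx det_lower_mx mul1r. Qed.

Lemma factored_unit : factored_mx \in unitmx.
Proof.
rewrite unitmxE det_factored unitr_prod_in // => i _ _; exact: J_pivot_unit.
Qed.

Local Notation qdiv := (qdiv K).

Lemma qdiv_walk_factored i j : qdiv (walk_mx i j - factored_mx i j).
Proof. by rewrite walk_factored; exact: qdiv_q. Qed.

(** If R and W are the inverses of M and F, then R - W = - W (M - F) R. *)
Lemma qdiv_resolvent i j : qdiv (resolvent_mx i j - invmx factored_mx i j).
Proof.
have -> : resolvent_mx i j - invmx factored_mx i j = - (invmx factored_mx *m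
    (walk_mx - factored_mx) *m resolvent_mx) i j.
  rewrite mulmxBr mulVmx ?factored_unit // mulmxBl -mulmxA walk_resolvent mulmx1.
  by rewrite mul1mx !mxE opprB.
apply: qdivN; apply: qdiv_mulmx; apply: qdiv_mulmxr => k l.
by rewrite mxE [X in _ + X]mxE; exact: qdiv_walk_factored.
Qed.

Lemma resolvent_J : qdiv (J * resolvent_mx ord0 ord0 - H_series).
Proof.
pose W := invmx factored_mx.
have W00 : J_pivot 0 * W ord0 ord0 = 1.
  have : lower_mx K (fun i => - (x * q ^+ i.+1)) J_pivot *m W *m
      upper_mx K (fun i => - (x * q ^+ i) / J_pivot i.+1) = 1%:M.
    by apply: mulmx1C; rewrite mulmxA mulmxV // factored_unit.
  by move=> /matrixP/(_ ord0 ord0); rewrite mulmx_upper0 lower_mulmx0 mxE.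
have -> : J * resolvent_mx ord0 ord0 - H_series =
    J * (resolvent_mx ord0 ord0 - W ord0 ord0).
  rewrite mulrBr; congr (_ - _).
  have <- : J_pivot 0 * H_series = J by rewrite -H_shift0 divrK // H_shift_unit.
  by rewrite mulrAC W00 mul1r.
by apply: qdivMr; exact: qdiv_resolvent.
Qed.

Definition trace_series : series :=
  Fps (fun n => if n is 0 then 0 else \tr (A ^+ n)).

Lemma euler_walk_mx : map_mx (@fps_euler _) walk_mx =
  \matrix_(i, j) (- (x * fps_const (A i j))).
Proof.
apply/matrixP => i j; rewrite mxE [walk_mx _ _]mxE [RHS]mxE raddfB /=.
rewrite fps_eulerM fps_euler_X fps_euler_const mulr0 addr0.
have -> : (i == j)%:R = fps_const (i == j)%:R :> series by rewrite rmorph_nat.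
by rewrite fps_euler_const sub0r.
Qed.

Lemma trace_walk_resolvent :
  \tr (map_mx (@fps_euler _) walk_mx *m resolvent_mx) = - trace_series.
Proof.
rewrite euler_walk_mx.
transitivity (- (x * \sum_i \sum_k fps_const (A i k) * resolvent_mx k i)).
  rewrite mulr_sumr -sumrN; apply: eq_bigr => i _.
  rewrite mxE mulr_sumr -sumrN; apply: eq_bigr => k _.
  by rewrite [X in X * _]mxE mulNr mulrA.
congr (- _); apply: fpsP => n; rewrite fps_coefMX; case: n => [//|n].
rewrite fps_coef_sum [RHS]/= exprS; apply: eq_bigr => i _.
rewrite fps_coef_sum mxE; apply: eq_bigr => k _.
by rewrite fps_coefCM [resolvent_mx _ _]mxE.
Qed.

(** Jacobi's formula is applied to [factored_mx], whose determinant is known, and the resulting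
    trace is compared with that of [walk_mx]. *)
Lemma qdiv_trace : qdiv (fps_dlog (\det factored_mx) + trace_series).
Proof.
rewrite (fps_dlog_det factored_unit) -[trace_series]opprK -trace_walk_resolvent.
set E := map_mx _; set W := invmx _; rewrite -raddfB /=.
have -> : E factored_mx *m W - E walk_mx *m resolvent_mx =
    E factored_mx *m (W - resolvent_mx) + (E factored_mx - E walk_mx) *m resolvent_mx.
  by rewrite mulmxBr mulmxBl addrA subrK.
apply: qdiv_sum => i; rewrite mxE; apply: qdivD.
  apply: qdiv_mulmxr => k l; rewrite mxE [X in _ + X]mxE -opprB.
  by apply: qdivN; exact: qdiv_resolvent.
apply: qdiv_mulmx => k l; rewrite mxE [X in _ + X]mxE -opprB; apply: qdivN.
rewrite [X in X - _]mxE [X in _ - X]mxE -raddfB /=; apply: qdiv_euler.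
exact: qdiv_walk_factored.
Qed.

(** The series x q^n / (1 - x q^n). *)
Definition geom n : series :=
  Fps (fun m => if m is 0 then 0 else base_q ^+ n ^+ m).

Lemma fps_dlog_geom n : fps_dlog (1 - x * q ^+ n) = - geom n.
Proof.
have u : 1 - x * q ^+ n \is a GRing.unit := unit_1BxM _.
apply: (mulIr u); rewrite divrK // raddfB /= (fps_euler_const 1) sub0r mulNr.
congr (- _); rewrite fps_eulerM fps_euler_X var_qX fps_euler_const mulr0 addr0.
rewrite mulrBr mulr1 [geom n * _]mulrC -mulrA; apply: fpsP => m.
rewrite fps_coefB !fps_coefMX; case: m => [|[|m]]; first by rewrite subr0.
  by rewrite fps_coefCM mulr0 subr0.
by rewrite fps_coefCM [(geom n)`@_]/= exprS subrr.
Qed.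

Lemma qdiv_dlog_J :
  qdiv (fps_dlog J + trace_series - \sum_(i < K) geom i.+1).
Proof.
have uprod n : \prod_(i < n) (1 - x * q ^+ i.+1) \is a GRing.unit.
  by rewrite unitr_prod_in // => i _ _; exact: unit_1BxM.
have uH := H_shift_unit K.
have e : fps_dlog (\det factored_mx) + fps_dlog (H_shift K) =
    fps_dlog J - \sum_(i < K) geom i.+1.
  rewrite -fps_dlogM ?det_factored //; last first.
    by rewrite unitr_prod_in // => i _ _; exact: J_pivot_unit.
  rewrite (pivot_prod x q J H_shift_unit) fps_dlogM ?J_unit //.
  rewrite (@fps_dlog_prod _ K (fun i => 1 - x * q ^+ i.+1)) => [|i]; last first.
    exact: unit_1BxM.
  by rewrite -sumrN; congr (_ + _); apply: eq_bigr => i _; exact: fps_dlog_geom.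
rewrite addrAC -e addrAC; apply: qdivD; first exact: qdiv_trace.
(* In H(x q^K) the coefficient of x^m is a multiple of q^(K m), and the derivation kills the term m
   = 0. *)
apply: qdivM => m k ltkK; case: m => [|m] //.
have -> : (fps_euler (H_shift K))`@m.+1 =
  (base_q ^+ K) ^+ m.+1 * H_series`@m.+1 *+ m.+1 by [].
rewrite -mulrnAr -exprM fps_coefMXn.
by rewrite (leq_trans ltkK) // leq_pmulr.
Qed.

End Truncation.

(** * Comparison of coefficients *)

Lemma lambert_coef n k :
  (lambert_xq`@n.+1)`@k = ((0 < k) && (n.+1 %| k))%N%:R.
Proof.
pose g : fps int := Fps (fun k => ((0 < k) && (n.+1 %| k))%N%:R).
suff gE : g * (1 - base_q ^+ n.+1) = base_q ^+ n.+1.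
  rewrite -[lambert_xq`@n.+1]/(base_q ^+ n.+1 / (1 - base_q ^+ n.+1)).
  by rewrite -{1}gE mulrK ?lambert_unit.
rewrite mulrBr mulr1 mulrC; apply: fpsP => {}k.
rewrite fps_coefB fps_coefMXn coef_base_qX.
have [lt|gt|->] := ltngtP k n.+1.
- rewrite subr0 /=; case: k lt => // k lt.
  by rewrite gtnNdvd.
- rewrite /= subn_gt0 gt (leq_ltn_trans _ gt) //= dvdn_subl ?subrr //.
  exact: ltnW.
- by rewrite subnn /= dvdnn subr0.
Qed.

(** Exchange of sums: over all [i >= 1] the coefficients of x^n add up to q^n + q^(2n) + ..., and
    those with [i > K] start beyond [q ^ k]. *)
Lemma sum_geom_coef K n k : (k < K)%N ->
  ((\sum_(i < K) geom i.+1)`@n)`@k = (lambert_xq`@n)`@k.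
Proof.
move=> ltkK; rewrite fps_coef_sum; case: n => [|n].
  by rewrite big1.
rewrite lambert_coef fps_coef_sum.
under eq_bigr do rewrite [(geom _)`@_]/= -exprM coef_base_qX.
case: (boolP (_ && _)) => [/andP[k0 /dvdnP[d kE]]|kn].
  have d0 : (0 < d)%N by move: k0; rewrite kE muln_gt0 => /andP[].
  have ltdK : (d.-1 < K)%N.
    by rewrite (leq_ltn_trans _ ltkK) // kE (leq_trans (leq_pred d)) // leq_pmulr.
  rewrite (bigD1 (Ordinal ltdK)) //= prednK // kE eqxx big1 ?addr0 // => i id.
  rewrite eqn_pmul2r //; case: eqP => // e; case/eqP: id; apply: val_inj.
  by rewrite /= e.
rewrite big1 // => i _; case: eqP => // e; case/negP: kn.
by rewrite e muln_gt0 dvdn_mull.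
Qed.

(** The empty walk gives the 1, and closed walks of length [n + 1] at height 0 give the coefficient
    of x^n in [S_xq]. For [q ^ k], heights up to [k + 1] suffice. *)
Lemma J_S_xq : J * (1 + x * S_xq) = H_series.
Proof.
apply/eqP; rewrite -subr_eq0; apply/eqP; apply: fpsP => n; apply: fpsP => k.
pose G := resolvent_mx k.+1 ord0 ord0.
have GE m : G`@m = (transfer_mx k.+1 ^+ m) ord0 ord0 by rewrite /G mxE.
have qG : qdiv k.+1 (1 + x * S_xq - G).
  move=> m l ltlk; rewrite fps_coefB -[(1 + _)`@m]/(_ + (x * S_xq)`@m).
  rewrite fps_coefMX GE; case: m => [|m].
    by rewrite expr0 mxE addr0 subrr.
  rewrite add0r (transfer_closed_coef m ord0 l).
  by rewrite -card_finite321 ?subrr // ltnW.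
have -> : J * (1 + x * S_xq) - H_series =
    J * (1 + x * S_xq - G) + (J * G - H_series).
  by rewrite mulrBr addrA subrK.
exact: (qdivD (qdivMr J qG) (@resolvent_J k.+1)).
Qed.

(** The trace includes the flat walks, which add the Lambert series twice, while the determinant
    yields it once. *)
Lemma aff_S_xqE : aff_S_xq = - fps_dlog J - lambert_xq.
Proof.
apply: fpsP => n; apply: fpsP => k; have := @qdiv_dlog_J k.+1 n k (ltnSn k).
have -> : (fps_dlog J + trace_series k.+1 - \sum_(i < k.+1) geom i.+1)`@n`@k =
    (fps_dlog J)`@n`@k + (trace_series k.+1)`@n`@k -
    (\sum_(i < k.+1) geom i.+1)`@n`@k by [].
have -> : (- fps_dlog J - lambert_xq)`@n`@k =
    - (fps_dlog J)`@n`@k - lambert_xq`@n`@k by [].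
rewrite sum_geom_coef //; move: (fps_dlog J)`@n`@k => d.
have -> : (trace_series k.+1)`@n`@k =
    aff_S_xq`@n`@k + lambert_xq`@n`@k *+ 2.
  case: n => [|n]; first by rewrite mul0rn addr0.
  rewrite lambert_coef (transfer_trace_coef k.+1 n k) card_codes // PoszD.
  by congr (_ + _); case: (_ && _).
by move=> e; lia.
Qed.

End WalkSeries.

Theorem theorem2p3 :
  S_xq = (1 - var_x * var_q)^-1 * (fps_scale base_q J / J) /\
  aff_S_xq = - var_x * (fps_deriv J / J) - lambert_xq.
Proof.
split; last by rewrite aff_S_xqE mulNr mulrA -fps_eulerE.
(* Both sides of J (1 + x S) = H = J + x J(xq) / (1 - xq) lose [J], then the factor [x]. *)
have JS : J * S_xq = J_shift.
  apply: fps_X_inj; have := J_S_xq.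
  by rewrite H_series_J mulrDr mulr1 mulrCA => /addrI.
rewrite -[LHS](mulKr J_unit) JS /J_shift.
by rewrite mulrC -mulrA [RHS]mulrC -mulrA [J^-1 * _]mulrC.
Qed.
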